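(* Suppose $\mu$ is an ergodic IRS of the Basilica group $\mathfrak{B}$ such that for $\mu$-a.e. $H$ the fixed point set $\mathrm{Fix}(H)\subseteq\partial\mathsf{T}$ is clopen (possibly empty), where $\mathsf{T}$ is the binary rooted tree. Then $\mu$ is atomic.
   Context: An IRS of a countable group $G$ is a Borel probability measure on $\mathrm{Sub}(G)\subset\{0,1\}^G$ invariant under conjugation; it is ergodic if ergodic for the conjugation action. $\mathsf{T}$ is the binary rooted tree (finite words over $\{0,1\}$) and $\partial\mathsf{T}$ the space of infinite words. Automorphisms act on the right; $g=(g_0,g_1)\sigma$ means $(vw)\cdot g=(v\cdot\sigma)(w\cdot g_v)$ for $v\in\{0,1\}$ and words $w$; $\varepsilon$ is the permutation exchanging $0$ and $1$. The Basilica group $\mathfrak{B}$ is the group generated by the two automorphisms $a=(1,b)$, $b=(1,a)\varepsilon$. For a subgroup $H$, $\mathrm{Fix}(H)=\{x\in\partial\mathsf{T}: x\cdot h=x\ \forall h\in H\}$. *)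

(* Defs.v *)
From HB Require Import structures.
From mathcomp Require Import all_boot all_order all_algebra.
From mathcomp Require Import boolp classical_sets functions reals ereal topology
  measure probability cantor.

Set Implicit Arguments.
Unset Strict Implicit.
Unset Printing Implicit Defensive.

Local Open Scope classical_set_scope.
Local Open Scope group_scope.

Record subgroup (G : groupType) := Subgroup {
  subgroup_pred :> {pred G};
  subgroupP : group_closed subgroup_pred }.

Lemma subgroup_inj (G : groupType) : injective (@subgroup_pred G).
Proof.
move=> [H cH] [K cK] /= HK; rewrite HK in cH *.
by rewrite (Prop_irrelevance cH cK).
Qed.

HB.instance Definition _ (G : groupType) := gen_eqMixin (subgroup G).
HB.instance Definition _ (G : groupType) := gen_choiceMixin (subgroup G).

Definition trivial_subgroup (G : groupType) : subgroup G.
Proof.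
by exists (pred1 (1 : G)); split=> [|x y]; rewrite !inE // => /eqP-> /eqP->;
  rewrite divg1.
Defined.

HB.instance Definition _ (G : groupType) :=
  isPointed.Build (subgroup G) (trivial_subgroup G).

(* The embedding Sub(G) -> {0,1}^G; the target carries the product topology. *)
Definition subgroup_indicator (G : groupType) (H : subgroup G) :
  prod_topology (fun _ : G => bool) := fun g => g \in H.

HB.instance Definition _ (G : groupType) :=
  Topological.copy (subgroup G) (initial_topology (@subgroup_indicator G)).

(* Sub(G) as a measurable space, with its Borel sigma-algebra. *)
Notation borel_subgroup G := (g_sigma_algebraType (@open (subgroup G))).

Lemma measurable_set1_subgroup (G : groupType) (H : borel_subgroup G) :
  measurable [set H].
Proof.
rewrite -[[set H]]setCK; apply: measurableC; apply: sub_sigma_algebra.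
exists (~` [set subgroup_indicator H]).
  rewrite openC; apply: accessible_closed_set1; apply: hausdorff_accessible.
  by apply: hausdorff_product => ?; exact: discrete_hausdorff.
rewrite -preimage_setC; congr (~` _); apply/seteqP; split=> [K /= KH|K /= -> //].
by apply: subgroup_inj; apply/funext => g; exact: (congr1 (@^~ g) KH).
Qed.

Section Conjugation.
Variable G : groupType.

Lemma conj_subgroup_subproof (H : subgroup G) (g : G) :
  group_closed [pred x | x ^ g^-1 \in H].
Proof.
have [H1 HV] := subgroupP H.
split=> [|x y]; rewrite !inE ?conj1g // => Hx Hy.
by rewrite conjMg conjVg HV.
Qed.

(* [H ^ g = g^-1 H g] *)
Definition conj_subgroup (g : G) (H : subgroup G) : subgroup G :=
  Subgroup (conj_subgroup_subproof H g).

End Conjugation.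

Section IRS.
Variables (G : groupType) (R : realType).
Implicit Type mu : probability (borel_subgroup G) R.

Definition is_IRS mu : Prop :=
  forall (g : G) (A : set (borel_subgroup G)), measurable A ->
    mu (conj_subgroup g @^-1` A) = mu A.

Definition ergodic_IRS mu : Prop :=
  is_IRS mu /\
  forall A : set (borel_subgroup G), measurable A ->
    (forall g : G, conj_subgroup g @^-1` A = A) ->
    mu A = 0%E \/ mu A = 1%E.

(* Atoms are points of positive mass; singletons are Borel by
   [measurable_set1_subgroup]. *)
Definition atomic mu : Prop :=
  forall A : set (borel_subgroup G), measurable A -> (0 < mu A)%E ->
    exists2 H : borel_subgroup G, A H & (0 < mu [set H])%E.

End IRS.

Definition generated (G : groupType) (S : set G) : {pred G} :=
  fun g => `[< forall H : subgroup G, (forall s, S s -> s \in H) -> g \in H >].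

Lemma generated_group_closed (G : groupType) (S : set G) :
  group_closed (generated S).
Proof.
split=> [|x y]; first by apply/asboolP => H _; case: (subgroupP H).
move=> /asboolP Sx /asboolP Sy; apply/asboolP => H SH.
by case: (subgroupP H) => _; apply; [exact: Sx|exact: Sy].
Qed.

(* A bijection of the set of finite words that fixes the root and maps
   children of [v] to children of the image of [v]. *)
Record tree_aut := TreeAut {
  tapp :> seq bool -> seq bool;
  tinv : seq bool -> seq bool;
  tappK : cancel tapp tinv;
  tinvK : cancel tinv tapp;
  tapp_root : tapp [::] = [::];
  tapp_child : forall v x, exists y, tapp (rcons v x) = rcons (tapp v) y }.

Lemma tree_aut_inj (g h : tree_aut) : tapp g =1 tapp h -> g = h.
Proof.
case: g h => [g gi gK giK g0 gc] [h hi hK hiK h0 hc] /= gh.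
have E : g = h by apply/funext.
have Ei : gi = hi by apply/funext => v; rewrite -[v in LHS]hiK -gh gK.
by subst; congr TreeAut; exact: Prop_irrelevance.
Qed.

HB.instance Definition _ := gen_eqMixin tree_aut.
HB.instance Definition _ := gen_choiceMixin tree_aut.

Definition tree_aut1 : tree_aut.
Proof. by exists id id => // v x; exists x. Defined.

(* Automorphisms act on the right: [v . (g h) = (v . g) . h]. *)
Definition tree_autM (g h : tree_aut) : tree_aut.
Proof.
exists (h \o g) (tinv g \o tinv h).
- by move=> v /=; rewrite !tappK.
- by move=> v /=; rewrite !tinvK.
- by rewrite /= !tapp_root.
- move=> v x /=; have [y ->] := tapp_child g v x; exact: tapp_child.
Defined.

Definition tree_autV (g : tree_aut) : tree_aut.
Proof.
exists (tinv g) g; [exact: tinvK|exact: tappK| |].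
- by rewrite -[in LHS](tapp_root g) tappK.
- move=> v x; case/lastP E: (tinv g (rcons v x)) => [|u y].
    have := tinvK g (rcons v x); rewrite E tapp_root.
    by move/(congr1 size); rewrite size_rcons.
  exists y; have [z gz] := tapp_child g u y.
  have := tinvK g (rcons v x); rewrite E gz => /rcons_inj[<- _].
  by rewrite tappK.
Defined.

Lemma tree_autMA : associative tree_autM.
Proof. by move=> g h k; exact: tree_aut_inj. Qed.
Lemma tree_aut1M : left_id tree_aut1 tree_autM.
Proof. by move=> g; exact: tree_aut_inj. Qed.
Lemma tree_autM1 : right_id tree_aut1 tree_autM.
Proof. by move=> g; exact: tree_aut_inj. Qed.
Lemma tree_autVM : left_inverse tree_aut1 tree_autV tree_autM.
Proof. by move=> g; apply: tree_aut_inj => v; exact: tinvK. Qed.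
Lemma tree_autMV : right_inverse tree_aut1 tree_autV tree_autM.
Proof. by move=> g; apply: tree_aut_inj => v; exact: tappK. Qed.

HB.instance Definition _ := isGroup.Build tree_aut
  tree_autMA tree_aut1M tree_autM1 tree_autVM tree_autMV.

(* The boundary of the tree is [cantor_space], i.e. infinite words with the
   product topology; the n-th letter of [x . g] is the last letter of the image
   of the prefix of length n.+1 of [x]. *)
Definition bact (x : cantor_space) (g : tree_aut) : cantor_space :=
  fun n => last false (g (mkseq x n.+1)).

Lemma mkseq_bact (x : cantor_space) (g : tree_aut) (n : nat) :
  mkseq (bact x g) n = g (mkseq x n).
Proof.
have mkseqS (f : nat -> bool) m : mkseq f m.+1 = rcons (mkseq f m) (f m).
  by rewrite /mkseq -addn1 iotaD map_cat cats1.
elim: n => [|n IHn]; first by rewrite /= tapp_root.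
rewrite mkseqS IHn /bact mkseqS.
by have [y ->] := tapp_child g (mkseq x n) (x n); rewrite last_rcons.
Qed.

(* [(g0, g1) s], where [s] permutes the letters. *)
Definition wreath (g0 g1 : seq bool -> seq bool) (s : bool -> bool)
    (v : seq bool) : seq bool :=
  if v is x :: w then s x :: (if x then g1 w else g0 w) else [::].

Fixpoint afun (v : seq bool) : seq bool :=
  match v with
  | [::] => [::]
  | false :: w => false :: w
  | true :: w => true :: bfun w
  end
with bfun (v : seq bool) : seq bool :=
  match v with
  | [::] => [::]
  | false :: w => true :: w
  | true :: w => false :: afun w
  end.

Fixpoint ainv (v : seq bool) : seq bool :=
  match v with
  | [::] => [::]
  | false :: w => false :: w
  | true :: w => true :: binv w
  end
with binv (v : seq bool) : seq bool :=
  match v with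
  | [::] => [::]
  | true :: w => false :: w
  | false :: w => true :: ainv w
  end.

Lemma abfunK v : ainv (afun v) = v /\ binv (bfun v) = v.
Proof. by elim: v => [|[] v [IHa IHb]] //=; rewrite ?IHa ?IHb. Qed.

Lemma abinvK v : afun (ainv v) = v /\ bfun (binv v) = v.
Proof. by elim: v => [|[] v [IHa IHb]] //=; rewrite ?IHa ?IHb. Qed.

Lemma abfun_child v x :
  (exists y, afun (rcons v x) = rcons (afun v) y) /\
  (exists y, bfun (rcons v x) = rcons (bfun v) y).
Proof.
elim: v x => [|z v IHv] x.
  by split; case: x; [exists true|exists false|exists false|exists true].
have [[y ya] [t tb]] := IHv x.
by split; case: z => /=; rewrite ?ya ?tb; do ?by eexists.
Qed.

Definition aut_a : tree_aut :=
  @TreeAut afun ainv (fun v => (abfunK v).1) (fun v => (abinvK v).1)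
    erefl (fun v x => (abfun_child v x).1).

Definition aut_b : tree_aut :=
  @TreeAut bfun binv (fun v => (abfunK v).2) (fun v => (abinvK v).2)
    erefl (fun v x => (abfun_child v x).2).

(* a = (1, b) and b = (1, a) eps, eps exchanging the two letters *)
Lemma aut_aE : tapp aut_a =1 wreath (1 : tree_aut) aut_b id.
Proof. by case=> [|[] v]. Qed.

Lemma aut_bE : tapp aut_b =1 wreath (1 : tree_aut) aut_a negb.
Proof. by case=> [|[] v]. Qed.

Definition basilica : Type :=
  {g : tree_aut | g \in generated [set aut_a; aut_b]}.

HB.instance Definition _ := SubChoice.on basilica.
HB.instance Definition _ := SubChoice_isSubGroup.Build
  tree_aut (generated [set aut_a; aut_b]) basilica
  (generated_group_closed [set aut_a; aut_b]).

Definition Fix (H : subgroup basilica) : set cantor_space :=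
  [set x | forall h : basilica, h \in H -> bact x (val h) = x].

(* Main.v *)
(* Write B for the Basilica group, c = [a, b], and gamma_3 for the
   normal closure of [c, b] in B; for a vertex w, let gamma_3(w) be the copy of gamma_3 acting
   below w.  Since c commutes with a, B / gamma_3 is polycyclic, gamma_3(w) is a
   subgroup of gamma_3, and every finite index subgroup of gamma_3(v) contains
   gamma_3(w) for arbitrarily small neighbourhoods w of any given point below v.

   Mass transport: for an IRS and fixed h, w, almost every H containing h
   is such that the elements u of gamma_3(w) with h ^ u in H generate a finite index
   subgroup.  If h in H moves v off itself, then [h, u] acts as u below v; so
   below some w extending v all of gamma_3(w) is induced by elements of H acting
   below v.  Applying the transport again to such an element k moving a vertex
   w', one finds commutators [k, u] in H, then [[k, u], u'] = [u, u'] in H, and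
   finally gamma_3(w'') <= H.  Thus every point not fixed by H has a
   neighbourhood w with gamma_3(w) <= H.

   When Fix(H) is open, compactness gives a level m at each vertex of which H is
   trivial or contains gamma_3(w).  As B / gamma_3 is Noetherian, H is generated
   by these gamma_3(w) and finitely many elements: there are countably many such
   subgroups, so mu is carried by a countable set. *)
Require Import Defs.
From mathcomp Require Import all_boot all_order all_algebra.
From mathcomp Require Import mathcomp_extra boolp classical_sets functions
  cardinality reals ereal topology sequences measure probability cantor.

Set Implicit Arguments.
Unset Strict Implicit.
Unset Printing Implicit Defensive.

Local Open Scope classical_set_scope.
Local Open Scope group_scope.

(** * Subgroups as sets *)

Section SubgroupSets.
Variable G : groupType.
Implicit Types (K S : set G) (x y : G).

Definition is_subgroup K := K 1 /\ forall x y, K x -> K y -> K (x * y^-1).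

Lemma subgroupV K : is_subgroup K -> forall x, K x -> K x^-1.
Proof. by move=> [K1 KD] x Kx; rewrite -[x^-1]mul1g; exact: KD. Qed.

Lemma subgroupM K : is_subgroup K -> forall x y, K x -> K y -> K (x * y).
Proof.
by move=> sK x y Kx Ky; rewrite -[y]invgK; apply: sK.2 => //; exact: subgroupV.
Qed.

Lemma subgroupJ K : is_subgroup K -> forall x y, K x -> K y -> K (x ^ y).
Proof.
move=> sK x y Kx Ky; rewrite conjgE; apply: subgroupM (subgroupV sK Ky) _ => //.
exact: subgroupM.
Qed.

Lemma subgroupR K : is_subgroup K -> forall x y, K x -> K y -> K [~ x, y].
Proof.
move=> sK x y Kx Ky; apply: subgroupM (subgroupV sK Kx) _ => //.
exact: subgroupJ.
Qed.

Lemma subgroupX K : is_subgroup K -> forall x n, K x -> K (x ^+ n).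
Proof.
move=> sK x n Kx; elim: n => [|n IHn]; first exact: sK.1.
by rewrite expgS; exact: subgroupM.
Qed.

Lemma is_subgroupI K L : is_subgroup K -> is_subgroup L ->
  is_subgroup (K `&` L).
Proof.
move=> [K1 KD] [L1 LD]; split=> // x y [Kx Lx] [Ky Ly].
by split; [exact: KD | exact: LD].
Qed.

Definition gspan S : set G := [set g | g \in generated S].

Lemma is_subgroup_gspan S : is_subgroup (gspan S).
Proof. exact: generated_group_closed. Qed.

Lemma sub_gspan S : S `<=` gspan S.
Proof. by move=> g Sg; apply/asboolP => H SH; exact: SH. Qed.

Lemma subgroup_asbool_subproof K : is_subgroup K ->
  group_closed [pred x | `[< K x >]].
Proof.
move=> [K1 KD]; split=> [|x y]; first exact: asboolT.
by move=> /asboolW Kx /asboolW Ky; apply: asboolT; exact: KD.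
Qed.

Lemma gspan_min K S : is_subgroup K -> S `<=` K -> gspan S `<=` K.
Proof.
move=> sK SK g /asboolP/(_ (Subgroup (subgroup_asbool_subproof sK))) gK.
by apply/asboolP; apply: gK => s /SK Ks; exact/asboolP.
Qed.

Lemma gspan_mono S S' : S `<=` S' -> gspan S `<=` gspan S'.
Proof.
move=> SS'; apply: gspan_min; first exact: is_subgroup_gspan.
exact: subset_trans SS' (@sub_gspan _).
Qed.

End SubgroupSets.

Lemma is_subgroup_preimage (G G' : groupType) (f : G -> G') (K : set G') :
  f 1 = 1 -> {morph f : x y / x * y^-1} -> is_subgroup K ->
  is_subgroup (f @^-1` K).
Proof.
move=> f1 fD [K1 KD]; split=> [|x y]; rewrite /preimage /= ?f1 // fD.
exact: KD.
Qed.

(** * Cyclic extensions and Noetherian quotients *)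

Section CyclicExtension.
Variables (G : groupType) (E : set G) (t : G).
Hypothesis sE : is_subgroup E.
Hypothesis EJ : forall x, E x -> E (x ^ t).
Hypothesis EJV : forall x, E x -> E (x ^ t^-1).

Lemma conjg_expgn n x : E x -> E (x ^ (t ^+ n)) /\ E (x ^ (t ^- n)).
Proof.
move=> Ex; elim: n => [|n [IH1 IH2]]; first by rewrite expg0 invg1 !conjg1.
split; first by rewrite expgSr conjgM; exact: EJ.
by rewrite expgS invgM conjgM; exact: EJV.
Qed.

(** The product of [E] with the cyclic group of [t]; integer exponents are split by sign. *)
Definition cyclic_ext : set G :=
  [set g | exists n, E (g * t ^- n) \/ E (g * t ^+ n)].

Let extM g x : cyclic_ext g -> E x -> cyclic_ext (g * x).
Proof.
move=> [n gn] Ex; exists n; have [En1 En2] := conjg_expgn n Ex.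
case: gn => gn; [left|right].
  have -> : g * x * t ^- n = g * t ^- n * x ^ (t ^- n).
    by rewrite conjgE invgK !mulgA mulgVK.
  exact: subgroupM.
have -> : g * x * t ^+ n = g * t ^+ n * x ^ (t ^+ n).
  by rewrite conjgE !mulgA mulgK.
exact: subgroupM.
Qed.

Let extT g : cyclic_ext g -> cyclic_ext (g * t).
Proof.
move=> [n [gn|gn]].
  by exists n.+1; left; rewrite expgSr invgM mulgA mulgK.
case: n gn => [|n] gn; last by exists n; right; rewrite -mulgA -expgS.
by exists 1%N; left; rewrite expg1 mulgK; move: gn; rewrite expg0 mulg1.
Qed.

Let extV g : cyclic_ext g -> cyclic_ext (g * t^-1).
Proof.
move=> [n [gn|gn]].
  case: n gn => [|n] gn; last first.
    by exists n; left; rewrite -mulgA -invgM -expgSr.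
  by exists 1%N; right; rewrite expg1 mulgVK; move: gn; rewrite expg0 divg1.
by exists n.+1; right; rewrite expgS !mulgA mulgVK.
Qed.

Lemma is_subgroup_cyclic_ext : is_subgroup cyclic_ext.
Proof.
split=> [|g h Xg [n [hn|hn]]].
- by exists 0%N; left; rewrite expg0 divg1; exact: sE.1.
- have -> : g * h^-1 = g * t ^- n * (h * t ^- n)^-1.
    by rewrite invgM invgK mulgA mulgVK.
  apply: extM (subgroupV sE hn); elim: n {hn} => [|n IHn].
    by rewrite expg0 divg1.
  by rewrite expgS invgM mulgA; exact: extV.
- have -> : g * h^-1 = g * t ^+ n * (h * t ^+ n)^-1.
    by rewrite invgM mulgA mulgK.
  apply: extM (subgroupV sE hn); elim: n {hn} => [|n IHn].
    by rewrite expg0 mulg1.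
  by rewrite expgSr mulgA; exact: extT.
Qed.

Lemma gspan_cyclic_ext : gspan (E `|` [set t]) `<=` cyclic_ext.
Proof.
apply: gspan_min; first exact: is_subgroup_cyclic_ext.
move=> x [Ex|->]; first by exists 0%N; left; rewrite expg0 divg1.
by exists 1%N; left; rewrite expg1 mulgV; exact: sE.1.
Qed.

End CyclicExtension.

(* When [D] is normal in [E], this says that [E / D] is Noetherian. *)
Definition noetherian_over (G : groupType) (D E : set G) :=
  forall K, is_subgroup K -> D `<=` K -> K `<=` E ->
    exists2 s : seq G, [set` s] `<=` K & K `<=` gspan (D `|` [set` s]).

Lemma noetherian_over_refl (G : groupType) (D : set G) : noetherian_over D D.
Proof.
move=> K _ DK KD; exists [::] => // x /KD Dx.
by apply: sub_gspan; left.
Qed.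

(** [K] is generated by its intersection with [E] and one element whose exponent of [t] is the least
    positive one. *)
Lemma noetherian_over_cyclic_ext (G : groupType) (D E : set G) (t : G) :
  is_subgroup E -> D `<=` E ->
  (forall x, E x -> E (x ^ t)) -> (forall x, E x -> E (x ^ t^-1)) ->
  noetherian_over D E -> noetherian_over D (gspan (E `|` [set t])).
Proof.
move=> sE DE EJ EJV nDE K sK DK KE.
have [x Dx|x [_ //]|s sKE Ks] := nDE _ (is_subgroupI sK sE).
  by split; [exact: DK | exact: DE].
have sK' : [set` s] `<=` K by move=> x /sKE[].
have [[n [k Kk Ek] nmin]|noK] := pselect (exists2 n,
    exists2 k, K k & E (k * t ^- n.+1) &
    forall i k, (i < n)%N -> K k -> ~ E (k * t ^- i.+1)).
- pose L := gspan (D `|` [set` k :: s]).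
  have sL : is_subgroup L := is_subgroup_gspan _.
  have sub x : K x -> E x -> L x.
    move=> Kx Ex; have := Ks x (conj Kx Ex); apply: gspan_mono => y [Dy|sy].
      by left.
    by right; rewrite /= inE sy orbT.
  have Lk : L k by apply: sub_gspan; right; rewrite /= inE eqxx.
  (* Division with remainder: a positive exponent below [n.+1] contradicts minimality, a larger one
     drops by [n.+1] on dividing by [k]. *)
  have pos m x : K x -> E (x * t ^- m) -> L x.
    elim/ltn_ind: m x => m IHm x Kx Ex.
    have [m0|m0] := posnP m.
      by apply: sub => //; move: Ex; rewrite m0 expg0 divg1.
    have [mn|nm] := leqP m n.
      by case: m m0 mn Ex {IHm} => // m _ mn Ex; case: (nmin m x).
    rewrite -[x](mulgVK k); apply: subgroupM => //.
    apply: (IHm (m - n.+1)%N); first by rewrite ltn_subrL m0.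
      exact: sK.2.
    have -> : x * k^-1 * t ^- (m - n.+1) =
        x * t ^- m * (k * t ^- n.+1)^-1 ^ (t ^- (m - n.+1)).
      move: (m - n.+1)%N (subnK nm) => p <-.
      by rewrite expgnDr conjgE; move: (t ^+ p) (t ^+ n.+1) => u v;
        rewrite !gnorm.
    apply: subgroupM => //; apply: (conjg_expgn EJ EJV _ _).2; exact: subgroupV.
  exists (k :: s) => [x|x Kx]; first by rewrite /= inE => /orP[/eqP->|/sK'].
  have [m [xm|xm]] := gspan_cyclic_ext sE EJ EJV (KE _ Kx); first exact: pos xm.
  rewrite -[x]invgK; apply: subgroupV => //; apply: (pos m);
    first exact: subgroupV.
  have -> : x^-1 * t ^- m = (x * t ^+ m)^-1 ^ (t ^- m).
    by rewrite conjgE; move: (t ^+ _) => p; rewrite !gnorm.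
  by apply: (conjg_expgn EJ EJV _ _).2; exact: subgroupV.
- exists s => // x Kx.
  have pos m y : K y -> E (y * t ^- m) -> E y.
    move=> Ky; case: m => [|m]; first by rewrite expg0 divg1.
    move=> Ey; exfalso; apply: noK.
    have exP : exists i, `[< exists2 k, K k & E (k * t ^- i.+1) >].
      by exists m; apply/asboolP; exists y.
    exists (ex_minn exP); case: ex_minnP => n /asboolP // nP nmin.
    move=> i z lt_in Kz Ez;
      suff /nmin : `[< exists2 k, K k & E (k * t ^- i.+1) >].
      by rewrite leqNgt lt_in.
    by apply/asboolP; exists z.
  apply: Ks; split=> //.
  have [m [xm|xm]] := gspan_cyclic_ext sE EJ EJV (KE _ Kx); first exact: pos xm.
  rewrite -[x]invgK; apply: subgroupV => //; apply: (pos m);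
    first exact: subgroupV.
  have -> : x^-1 * t ^- m = (x * t ^+ m)^-1 ^ (t ^- m).
    by rewrite conjgE; move: (t ^+ _) => p; rewrite !gnorm.
  by apply: (conjg_expgn EJ EJV _ _).2; exact: subgroupV.
Qed.

(** * Subgroups of finite index *)

Definition finite_index (G : groupType) (A S : set G) :=
  exists2 s : seq G, [set` s] `<=` A &
    forall g, A g -> exists2 r, r \in s & S (r^-1 * g).

Lemma sub_finite_index (G : groupType) (A S S' : set G) :
  S `<=` S' -> finite_index A S -> finite_index A S'.
Proof.
move=> SS' [s sA sP]; exists s => // g /sP[r rs rg]; exists r => //; exact: SS'.
Qed.

Lemma pigeonhole (T : finType) (f : nat -> T) :
  exists i j, (i < j)%N /\ f i = f j.
Proof.
apply: contrapT => nex.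
have : injective (fun i : 'I_(#|T|).+1 => f i).
  move=> i j fij; apply: val_inj; case: (ltngtP (val i) (val j)) => // ij.
    by exfalso; apply: nex; exists i, j.
  by exfalso; apply: nex; exists j, i.
by move/leq_card; rewrite card_ord ltnn.
Qed.

(* Pigeonhole for the permutation action of [A] on the cosets of [S]. *)
Lemma finite_index_core (G : groupType) (A S : set G) (e : nat -> G) :
  is_subgroup A -> is_subgroup S -> finite_index A S -> (forall i, A (e i)) ->
  exists i j, (i < j)%N /\ forall y, A y -> S (((e j)^-1 * e i) ^ y).
Proof.
move=> sA sS [s sA' sP] Ae.
have sAe (l : 'I_(size s)) : A s`_l by apply: sA'; exact: mem_nth.
have /choice[f fP] : forall il : nat * 'I_(size s),
    exists m : 'I_(size s), S ((s`_m)^-1 * (e il.1 * s`_il.2)).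
  move=> [i l] /=; have [r rs Sr] := sP _ (subgroupM sA (Ae i) (sAe l)).
  have rlt : (index r s < size s)%N by rewrite index_mem.
  by exists (Ordinal rlt); rewrite /= nth_index.
have [i [j [ij fij]]] := pigeonhole (fun i => [ffun l => f (i, l)]).
exists i, j; split=> // y Ay; have [r rs Sr] := sP y Ay.
have rlt : (index r s < size s)%N by rewrite index_mem.
set l := Ordinal rlt.
have := congr1 (fun g : {ffun _ -> _} => g l) fij; rewrite !ffunE => fl.
have := fP (i, l); have := fP (j, l); rewrite -fl /= nth_index // => Sj Si.
rewrite -[y](mulVKg r) conjgM; apply: subgroupJ => //.
rewrite conjgE; move: (subgroupM sS (subgroupV sS Sj) Si).
by rewrite !invgM !invgK !mulgA mulgK.
Qed.

(** * Normal closures and the third term of the lower central series *)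

Section NormalClosure.
Variables (G : groupType) (B : set G).
Hypothesis sB : is_subgroup B.
Implicit Types (t f g : G) (K : set G).

Definition normal_in K := forall f g, K f -> B g -> K (f ^ g).

Definition ncl t : set G := gspan [set t ^ g | g in B].

Lemma is_subgroup_ncl t : is_subgroup (ncl t).
Proof. exact: is_subgroup_gspan. Qed.

Lemma normal_gspan (S : set G) :
  (forall f g, S f -> B g -> gspan S (f ^ g)) -> normal_in (gspan S).
Proof.
move=> SJ f g + Bg; move: f.
apply: gspan_min => [|f Sf]; last exact: SJ.
apply: is_subgroup_preimage (is_subgroup_gspan _); first exact: conj1g.
by move=> x y; rewrite conjMg conjVg.
Qed.

Lemma normal_ncl t : normal_in (ncl t).
Proof.
apply: normal_gspan => _ g [k Bk <-] Bg; apply: sub_gspan.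
by exists (k * g); [exact: subgroupM | rewrite conjgM].
Qed.

Lemma ncl_mem t : ncl t t.
Proof. by apply: sub_gspan; exists 1; [exact: sB.1 | rewrite conjg1]. Qed.

Lemma ncl_min K t : is_subgroup K -> normal_in K -> K t -> ncl t `<=` K.
Proof. by move=> sK KJ Kt; apply: gspan_min => // _ [g Bg <-]; exact: KJ. Qed.

Lemma ncl_sub t : B t -> ncl t `<=` B.
Proof. by apply: ncl_min => // f g; exact: subgroupJ. Qed.

End NormalClosure.

(* With [c = [a, b]] this is the third term of the lower central series when
   [c] commutes with [a]. *)
Section ThirdTerm.
Variables (G : groupType) (a b c : G).
Let B := gspan [set a; b].
Let D := ncl B [~ c, b].
Hypothesis aJb : a ^ b = a * c.
Hypothesis cJa : c ^ a = c.

Let sB : is_subgroup B. Proof. exact: is_subgroup_gspan. Qed.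
Let sD : is_subgroup D. Proof. exact: is_subgroup_ncl. Qed.
Let DJ : normal_in B D. Proof. exact: normal_ncl. Qed.
Let Ba : B a. Proof. by apply: sub_gspan; left. Qed.
Let Bb : B b. Proof. by apply: sub_gspan; right. Qed.

Let Bc : B c.
Proof.
rewrite -(mulKg a c) -aJb; apply: (subgroupM sB); first exact: (subgroupV sB).
exact: (subgroupJ sB).
Qed.

(** Commuting with [c] modulo [D] defines a subgroup, which contains both generators of [B]. *)
Let c_central g : B g -> D [~ c, g].
Proof.
suff: B `<=` B `&` [set g | D [~ c, g]] by move=> BX /BX[].
apply: gspan_min => [|_ [->|->]]; last 2 first.
- by split; rewrite //= commgEl cJa mulVg; exact: sD.1.
- by split=> //; exact: ncl_mem.
split=> [|f h [Bf Df] [Bh Dh]]; first by split; rewrite /= ?commg1;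
  [exact: sB.1 | exact: sD.1].
split; rewrite /=; first exact: sB.2.
have BhV := subgroupV sB Bh.
have -> : [~ c, f * h^-1] = [~ c, h]^-1 ^ h^-1 * [~ c, f] ^ h^-1.
  by rewrite /commg /conjg !gnorm.
apply: (subgroupM sD); last exact: DJ.
by apply: DJ => //; exact: (subgroupV sD).
Qed.

(** The elements of [B] that are central modulo [D] form a normal subgroup containing [c]. *)
Lemma ncl_central f g : ncl B c f -> B g -> D [~ f, g].
Proof.
suff: ncl B c `<=` B `&` [set f | forall g, B g -> D [~ f, g]].
  by move=> BX /BX[_ fD] /fD.
apply: ncl_min; last by split; [exact: Bc | exact: c_central].
- split=> [|k k' [Bk kD] [Bk' k'D]].
    by split=> [|h _]; rewrite ?comm1g; [exact: sB.1 | exact: sD.1].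
  split=> [|h Bh]; first exact: sB.2.
  have -> : [~ k * k'^-1, h] = ([~ k, h] * [~ k', h]^-1) ^ k'^-1.
    by rewrite /commg /conjg !gnorm.
  apply: DJ; last exact: (subgroupV sB).
  by apply: sD.2; [exact: kD | exact: k'D].
- move=> k h [Bk kD] Bh; split=> [|h' Bh']; first exact: (subgroupJ sB).
  have -> : [~ k ^ h, h'] = [~ k, h' ^ h^-1] ^ h by rewrite conjRg conjgKV.
  apply: DJ => //; apply: kD; apply: (subgroupJ sB) => //.
  exact: (subgroupV sB).
Qed.

(** [B] is reached from [D] by adjoining [c], [a], [b] in turn, each normalising the group before
    it. *)
Lemma noetherian_third_term : noetherian_over D B.
Proof.
pose E1 := gspan (D `|` [set c]).
pose E2 := gspan (E1 `|` [set a]).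
pose E3 := gspan (E2 `|` [set b]).
have sE1 : is_subgroup E1 := is_subgroup_gspan _.
have sE2 : is_subgroup E2 := is_subgroup_gspan _.
have DE1 : D `<=` E1 by move=> x Dx; apply: sub_gspan; left.
have E12 : E1 `<=` E2 by move=> x Ex; apply: sub_gspan; left.
have E1c : E1 c by apply: sub_gspan; right.
have E2a : E2 a by apply: sub_gspan; right.
have BE3 : B `<=` E3.
  apply: gspan_min; first exact: is_subgroup_gspan.
  by move=> _ [->|->]; apply: sub_gspan; [left | right].
have E1J : normal_in B E1.
  apply: normal_gspan => x g [Dx|->] Bg; first by apply: DE1; exact: DJ.
  rewrite -[_ ^ _](mulVKg c) -commgEl; apply: (subgroupM sE1) => //.
  by apply: DE1; exact: c_central.
have E2J g : B g -> E2 (a ^ g) -> forall x, E2 x -> E2 (x ^ g).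
  move=> Bg ag; apply: gspan_min => [|x [Ex|->//]].
    apply: is_subgroup_preimage sE2; first exact: conj1g.
    by move=> x y; rewrite conjMg conjVg.
  by apply: E12; exact: E1J.
have BaV := subgroupV sB Ba; have BbV := subgroupV sB Bb.
have BcV := subgroupV sB Bc.
have nE1 : noetherian_over D E1.
  apply: noetherian_over_cyclic_ext => //.
  - by move=> x Dx; exact: DJ.
  - by move=> x Dx; exact: DJ.
  - exact: noetherian_over_refl.
have nE2 : noetherian_over D E2.
  by apply: noetherian_over_cyclic_ext => // x Ex; exact: E1J.
suff nE3 : noetherian_over D E3.
  by move=> K sK DK KB; apply: nE3 => //; exact: subset_trans KB BE3.
apply: noetherian_over_cyclic_ext => //; first exact: subset_trans DE1 E12.
  by apply: E2J => //; rewrite aJb; apply: (subgroupM sE2) => //; exact: E12.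
apply: E2J => //.
have -> : a ^ b^-1 = a * (c ^ b^-1)^-1.
  apply: (conjg_inj b); rewrite conjgKV conjMg aJb conjVg conjgKV.
  by rewrite mulgK.
by apply: sE2.2 => //; apply: E12; exact: E1J.
Qed.

End ThirdTerm.

(** * Automorphisms of the tree *)

Section TreeAutomorphisms.
Implicit Types (f g h : tree_aut) (u v w z : seq bool).

Lemma tree_autME f g v : (f * g) v = g (f v). Proof. by []. Qed.

Lemma tappVK g : cancel (tapp (g^-1)%g) g. Proof. exact: tinvK. Qed.
Lemma tappKV g : cancel g (tapp (g^-1)%g). Proof. exact: tappK. Qed.

Lemma size_tapp g v : size (g v) = size v.
Proof.
elim/last_ind: v => [|v x IHv]; first by rewrite tapp_root.
by have [y ->] := tapp_child g v x; rewrite !size_rcons IHv.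
Qed.

Lemma tapp_cat g v z : exists2 z', g (v ++ z) = g v ++ z' & size z' = size z.
Proof.
elim/last_ind: z => [|z x [z' gz sz]]; first by exists [::]; rewrite ?cats0.
have [y gy] := tapp_child g (v ++ z) x; exists (rcons z' y).
  by rewrite -rcons_cat gy gz rcons_cat.
by rewrite !size_rcons sz.
Qed.

Lemma tapp_prefix g v z : prefix (g v) (g z) = prefix v z.
Proof.
have pfx h u y : prefix u y -> prefix (h u) (h y).
  by move=> /prefixP[t ->]; have [t' -> _] := tapp_cat h u t;
    exact: prefix_prefix.
apply/idP/idP; last exact: pfx.
by move/(pfx g^-1); rewrite !tappKV.
Qed.

Lemma tapp_catl g v z v' : g (v ++ z) = v' ++ z -> size v = size v' -> g v = v'.
Proof.
have [z' -> _] := tapp_cat g v z => /eqP + sv.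
by rewrite eqseq_cat ?size_tapp // => /andP[/eqP].
Qed.

(** If [f] fixes [z] but not [g z], then [g] fixes [g z], and injectivity gives [g z = z]. *)
Lemma tree_aut_commute f g : (forall z, f z = z \/ g z = z) -> commute f g.
Proof.
move=> fg; apply: tree_aut_inj => z; rewrite /= /tree_autM /=.
have [fz|gz] := fg z.
  rewrite fz; have [//|ggz] := fg (g z).
  by move/(can_inj (tappK g)): ggz => ->; rewrite fz.
rewrite gz; have [ffz|//] := fg (f z).
by move/(can_inj (tappK f)): ffz => ->; rewrite gz.
Qed.

(** * Rigid stabilisers, sections and copies below a vertex *)

Definition rist w : set tree_aut := [set g | forall z, ~~ prefix w z ->
  g z = z].

Lemma is_subgroup_rist w : is_subgroup (rist w).
Proof.
split=> // f g fw gw z wz; rewrite tree_autME fw //.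
by rewrite -[in LHS](gw z) // tappKV.
Qed.

Lemma ristJ w f g : rist w f -> rist (g w) (f ^ g).
Proof.
move=> fw z wz; rewrite conjgE !tree_autME fw ?tappVK //.
by rewrite -(tapp_prefix g) tappVK.
Qed.

Lemma prefix_eq_size u v z : size u = size v -> prefix u z -> prefix v z ->
  u = v.
Proof. by move=> uv; rewrite !prefixE => /eqP <- /eqP <-; rewrite uv. Qed.

Lemma rist_commute u v f g : size u = size v -> u != v ->
  rist u f -> rist v g -> commute f g.
Proof.
move=> suv uv fu gv; apply: tree_aut_commute => z.
have [uz|uz] := boolP (prefix u z); last by left; exact: fu.
right; apply: gv; apply/negP => vz.
by move/eqP: uv; apply; exact: prefix_eq_size vz.
Qed.

(** [g] fixes [w] and has section [f] there; being a relation, it says nothing about sections at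
    moved vertices. *)
Definition acts_at w g f := forall v, g (w ++ v) = w ++ f v.

Lemma acts_at_fix w g f : acts_at w g f -> g w = w.
Proof. by move=> /(_ [::]); rewrite !cats0 tapp_root cats0. Qed.

Lemma acts_at1 w : acts_at w 1 1. Proof. by []. Qed.

Lemma acts_atV w g f : acts_at w g f -> acts_at w g^-1 f^-1.
Proof.
move=> gf v; apply: (can_inj (tappK g)).
by rewrite tappVK gf tappVK.
Qed.

Lemma acts_atM w g g' f f' : acts_at w g f -> acts_at w g' f' ->
  acts_at w (g * g') (f * f').
Proof. by move=> gf gf' v; rewrite !tree_autME gf gf'. Qed.

Lemma acts_atJ w g g' f f' : acts_at w g f -> acts_at w g' f' ->
  acts_at w (g ^ g') (f ^ f').
Proof.
by move=> gf gf'; rewrite !conjgE; apply: acts_atM (acts_atV _) (acts_atM _ _).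
Qed.

Lemma acts_at_cat u v g f e : acts_at u g f -> acts_at v f e ->
  acts_at (u ++ v) g e.
Proof. by move=> gf fe z; rewrite -!catA gf fe. Qed.

Lemma acts_at_inj w g f f' : acts_at w g f -> acts_at w g f' -> f = f'.
Proof.
move=> gf gf'; apply: tree_aut_inj => v; have := gf v.
by rewrite gf' => /eqP; rewrite eqseq_cat // => /andP[_ /eqP].
Qed.

Section Pair.
Variables (g0 g1 : tree_aut) (s : bool).

Definition pair_aut_inv (v : seq bool) : seq bool :=
  if v is y :: w then
    let x := y (+) s in x :: (if x then tinv g1 w else tinv g0 w)
  else [::].

Lemma pair_autK : cancel (wreath g0 g1 (addb^~ s)) pair_aut_inv.
Proof. by case=> [|x v] //=; rewrite addbK; case: x; rewrite tappK. Qed.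

Lemma pair_autVK : cancel pair_aut_inv (wreath g0 g1 (addb^~ s)).
Proof. by case=> [|x v] //=; rewrite addbK; case: (x (+) s); rewrite tinvK. Qed.

Lemma pair_aut_child v x : exists y,
  wreath g0 g1 (addb^~ s) (rcons v x) = rcons (wreath g0 g1 (addb^~ s) v) y.
Proof.
case: v => [|z v] /=; first by exists (x (+) s); case: x; rewrite tapp_root.
by case: z; [have [y ->] := tapp_child g1 v x | have [y ->] :=
  tapp_child g0 v x];
  exists y.
Qed.

Definition pair_aut : tree_aut :=
  @TreeAut _ _ pair_autK pair_autVK erefl pair_aut_child.

End Pair.

(** The pair with [g] in coordinate [x] and 1 in the other; iterated, [deltas w g] is the copy of
    [g] acting below [w]. *)
Definition delta (x : bool) g : tree_aut :=
  if x then pair_aut 1 g false else pair_aut g 1 false.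

Definition deltas w g : tree_aut := foldr delta g w.

Lemma delta_cons x g y v : delta x g (y :: v) = y :: if x == y then g v else v.
Proof. by case: x; case: y. Qed.

Lemma acts_at_delta x g : acts_at [:: x] (delta x g) g.
Proof. by move=> v; rewrite /= delta_cons eqxx. Qed.

Lemma acts_at_deltas w g : acts_at w (deltas w g) g.
Proof.
elim: w => [|x w IHw] //; rewrite -cat1s /=.
exact: acts_at_cat (acts_at_delta _ _) IHw.
Qed.

Lemma rist_deltas w g : rist w (deltas w g).
Proof.
elim: w => [|x w IHw] [|y z] //=; first by rewrite tapp_root.
by rewrite delta_cons; case: eqP => //= _ /IHw ->.
Qed.

(** Support and section determine an automorphism; the algebraic rules for [deltas] come from this
    uniqueness. *)
Lemma rist_acts_deltas w f g : rist w f -> acts_at w f g -> f = deltas w g.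
Proof.
move=> fw fg; apply: tree_aut_inj => z.
have [/prefixP[v ->]|wz] := boolP (prefix w z).
  by rewrite fg acts_at_deltas.
by rewrite fw // rist_deltas.
Qed.

Lemma deltas1 w : deltas w 1 = 1.
Proof. by apply/esym/rist_acts_deltas;
  [exact: (is_subgroup_rist w).1 | exact: acts_at1]. Qed.

Lemma deltasM w : {morph deltas w : f g / f * g}.
Proof.
move=> f g; apply/esym/rist_acts_deltas.
  by apply: (subgroupM (is_subgroup_rist w)); exact: rist_deltas.
by apply: acts_atM; exact: acts_at_deltas.
Qed.

Lemma deltasV w : {morph deltas w : f / f^-1}.
Proof.
move=> f; apply/esym/rist_acts_deltas.
  by apply: (subgroupV (is_subgroup_rist w)); exact: rist_deltas.
by apply: acts_atV; exact: acts_at_deltas.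
Qed.

Lemma deltasJ w : {morph deltas w : f g / f ^ g}.
Proof. by move=> f g; rewrite !conjgE !deltasM deltasV. Qed.

Lemma deltasR w : {morph deltas w : f g / [~ f, g]}.
Proof. by move=> f g; rewrite !commgEl deltasM deltasV deltasJ. Qed.

Lemma deltas_cat u v g : deltas (u ++ v) g = deltas u (deltas v g).
Proof. by rewrite /deltas foldr_cat. Qed.

Lemma deltas_conj w g k f : acts_at w k f -> deltas w g ^ k = deltas w (g ^ f).
Proof.
move=> kf; apply: rist_acts_deltas;
  last exact: acts_atJ (acts_at_deltas _ _) kf.
by rewrite -[w in rist w](acts_at_fix kf); apply: ristJ; exact: rist_deltas.
Qed.

Lemma is_subgroup_deltas w (K : set tree_aut) :
  is_subgroup K -> is_subgroup (deltas w @` K).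
Proof.
move=> [K1 KD]; split; first by exists 1; rewrite ?deltas1.
move=> _ _ [f Kf <-] [g Kg <-]; exists (f * g^-1); first exact: KD.
by rewrite deltasM deltasV.
Qed.

Lemma is_subgroup_preimage_deltas w (K : set tree_aut) :
  is_subgroup K -> is_subgroup (deltas w @^-1` K).
Proof.
apply: is_subgroup_preimage; first exact: deltas1.
by move=> f g; rewrite deltasM deltasV.
Qed.

End TreeAutomorphisms.

Arguments rist_deltas : clear implicits.

(** * The Basilica group *)

Notation Bas := (gspan [set aut_a; aut_b]).
Notation comm_ab := [~ aut_a, aut_b].
Notation comm_abb := [~ [~ aut_a, aut_b], aut_b].

Lemma Bas_a : Bas aut_a. Proof. by apply: sub_gspan; left. Qed.
Lemma Bas_b : Bas aut_b. Proof. by apply: sub_gspan; right. Qed.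
#[local] Hint Resolve Bas_a Bas_b : core.

Lemma is_subgroup_Bas : is_subgroup Bas. Proof. exact: is_subgroup_gspan. Qed.

Lemma aut_a_deltas : aut_a = deltas [:: true] aut_b.
Proof. by apply: tree_aut_inj => -[|[] v]. Qed.

Lemma deltas0J g : deltas [:: false] g ^ aut_b = deltas [:: true] g.
Proof.
by apply: tree_aut_inj => -[|[] v] //=; rewrite /conjg /= ?(abinvK v).1.
Qed.

Lemma deltas1J g : deltas [:: true] g ^ aut_b = deltas [:: false] (g ^ aut_a).
Proof. by apply: tree_aut_inj => -[|[] v]. Qed.

Lemma aut_aJb : aut_a ^ aut_b = deltas [:: false] (aut_b ^ aut_a).
Proof. by rewrite {1}aut_a_deltas deltas1J. Qed.

Lemma deltas01_commute f g : commute (deltas [:: false] f) (deltas [:: true] g).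
Proof. by apply: (@rist_commute [:: false] [:: true]) => //;
  exact: rist_deltas. Qed.

(** [a ^ b = (b ^ a, 1)] and [a = (1, b)] have disjoint supports, so [a] commutes with [[a, b] =
    a^-1 * a ^ b]. *)
Lemma comm_abJa : comm_ab ^ aut_a = comm_ab.
Proof.
apply/conjg_fixP/commgP; apply: commute_sym; rewrite commgEl.
apply: commuteM; first by apply: commuteV; exact: commute_refl.
by rewrite aut_aJb {1}aut_a_deltas; apply: commute_sym; exact: deltas01_commute.
Qed.

(** With [c = [a, b]], the product [c * c ^ b] telescopes to [a^-1 * a ^ (b ^+ 2) = (1, b^-1 * b ^
    a) = (1, c^-1)]. *)
Lemma deltas1_comm_ab : deltas [:: true] comm_ab = (comm_ab * comm_ab ^
  aut_b)^-1.
Proof.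
have -> : comm_ab * comm_ab ^ aut_b = aut_a^-1 * (aut_a ^ aut_b) ^ aut_b.
  by rewrite commgEl conjMg conjVg mulgA mulgK.
rewrite aut_aJb deltas0J {2}aut_a_deltas -deltasV -deltasM -deltasV.
by rewrite invgM invgK -conjVg commgEr.
Qed.

Lemma deltas0_comm_ab : deltas [:: false] comm_ab = deltas [:: true] comm_ab ^
  aut_b.
Proof. by rewrite deltas1J comm_abJa. Qed.

(** Generators suffice, and they occur as sections thanks to [b ^+ 2 = (a, a)], [a = (1, b)] and
    [a ^ b = (b ^ a, 1)]. *)
Lemma Bas_section x g : Bas g -> exists2 k, Bas k & acts_at [:: x] k g.
Proof.
have sX : is_subgroup [set g | exists2 k, Bas k & acts_at [:: x] k g].
  split; first by exists 1; [exact: is_subgroup_Bas.1 | exact: acts_at1].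
  move=> f f' [k Bk kf] [k' Bk' kf']; exists (k * k'^-1);
    first exact: is_subgroup_Bas.2.
  exact: acts_atM kf (acts_atV kf').
move: g; apply: gspan_min => // g ab.
case: x sX ab => sX.
- case=> ->; last by exists aut_a => // v.
  exists (aut_b ^+ 2) => //; exact: subgroupX is_subgroup_Bas _ _ Bas_b.
- case=> ->.
    exists (aut_b ^+ 2) => //; exact: subgroupX is_subgroup_Bas _ _ Bas_b.
  have Xa : exists2 k, Bas k & acts_at [:: false] k aut_a.
    by exists (aut_b ^+ 2) => //; exact: subgroupX is_subgroup_Bas _ _ Bas_b.
  have Xba : exists2 k, Bas k & acts_at [:: false] k (aut_b ^ aut_a).
    exists (aut_a ^ aut_b);
      first exact: subgroupJ is_subgroup_Bas _ _ Bas_a Bas_b.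
    by rewrite aut_aJb; exact: acts_at_deltas.
  by have := @subgroupJ _ _ sX (aut_b ^ aut_a) aut_a^-1 Xba (@subgroupV _ _ sX
    aut_a Xa); rewrite conjgK.
Qed.

Lemma Bas_sections w g : Bas g -> exists2 k, Bas k & acts_at w k g.
Proof.
elim: w g => [|x w IHw] g Bg; first by exists g.
have [f Bf fg] := IHw _ Bg; have [k Bk kf] := Bas_section x Bf.
by exists k => //; exact: (acts_at_cat kf fg).
Qed.

(** Self-similarity, the converse of [Bas_sections]: pairs with coordinates in the group are closed
    under products and inverses. *)
Lemma Bas_acts_at w g : Bas g -> g w = w -> exists2 f, Bas f & acts_at w g f.
Proof.
elim: w g => [|x w IHw] g Bg gw; first by exists g.
have [s [g0 [g1 [B0 B1 gE]]]] : exists s g0 g1,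
    [/\ Bas g0, Bas g1 & g =1 wreath g0 g1 (addb^~ s)].
  move: g Bg {gw}; apply: (@gspan_min _ [set g : tree_aut | exists s g0 g1,
    [/\ Bas g0, Bas g1 & g =1 wreath g0 g1 (addb^~ s)]]).
    split; first by exists false, 1, 1; split=> [||[|[] v]];
      try exact: is_subgroup_Bas.1.
    move=> f h [s [f0 [f1 [B0 B1 fE]]]] [t [h0 [h1 [C0 C1 hE]]]].
    have hVE : tapp (h^-1)%g =1 wreath (tapp (if t then h1 else h0)^-1%g)
        (tapp (if t then h0 else h1)^-1%g)
        (addb^~ t).
      move=> v; apply: (can_inj (tappK h)); rewrite tappVK hE.
      by case: v t {hE} => [|[] v] [] //=; rewrite tappVK.
    exists (s (+) t), (f0 * (if s (+) t then h1 else h0)^-1),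
      (f1 * (if s (+) t then h0 else h1)^-1).
    split; [| |move=> v].
    - by apply: is_subgroup_Bas.2 => //; case: ifP.
    - by apply: is_subgroup_Bas.2 => //; case: ifP.
    - rewrite tree_autME hVE fE.
      by case: v s t {fE hE hVE} => [|[] v] [] [].
  move=> g [->|->].
    by exists false, 1, aut_b; split=> //;
      [exact: is_subgroup_Bas.1 | case=> [|[] v]].
  by exists true, 1, aut_a; split=> //;
    [exact: is_subgroup_Bas.1 | case=> [|[] v]].
move: (gw); rewrite gE /= => -[xs gw'].
have s0 : s = false by case: (x) (s) xs => [] [].
have [||f Bf gf] := IHw (if x then g1 else g0); first by case: (x).
  by case: (x) gw'.
exists f => // v; rewrite gE /= s0 addbF; congr (_ :: _).
by case: (x) gf => gf; rewrite gf.
Qed.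

(* Self-replication: it suffices to check a normal generator. *)
Lemma ncl_deltas (K : set tree_aut) w t : is_subgroup K -> normal_in Bas K ->
  K (deltas w t) -> forall g, ncl Bas t g -> K (deltas w g).
Proof.
move=> sK KJ Kt; apply: gspan_min; first exact: is_subgroup_preimage_deltas.
move=> _ [g Bg <-]; have [k Bk kg] := Bas_sections w Bg.
by rewrite /preimage /= -(deltas_conj _ kg); exact: KJ.
Qed.

Notation gamma3 := (ncl Bas comm_abb).

Lemma aut_aJb_comm : aut_a ^ aut_b = aut_a * comm_ab.
Proof. by rewrite commgEl mulVKg. Qed.

Lemma acts_at_comm_ab : acts_at [:: false] comm_ab (aut_b ^ aut_a).
Proof. by []. Qed.

(** The second coordinate of [[[a, b], b]] is [b * b ^ a], whose sections [b^-1 * a] and [a * b]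
    exchange the letters; this moves every vertex below 1, and conjugation by [b] treats those below
    0. *)
Lemma gamma3_moves v : size v = 3 -> exists2 g, gamma3 g & g v != v.
Proof.
case: v => [|x [|y [|z []]]] // _; case: x.
  exists comm_abb; first exact: ncl_mem is_subgroup_Bas _.
  by case: y z => [] [].
exists (comm_abb ^ aut_b).
  exact: (normal_ncl is_subgroup_Bas (ncl_mem is_subgroup_Bas _) Bas_b).
by case: y z => [] [].
Qed.

(* The remaining computations are group-theoretic: unification should not
   compute with words. *)
#[local] Opaque aut_a aut_b deltas.

Lemma Bas_comm_ab : Bas comm_ab.
Proof. exact: (subgroupR is_subgroup_Bas Bas_a Bas_b). Qed.

Lemma Bas_comm_abb : Bas comm_abb.
Proof. exact: (subgroupR is_subgroup_Bas Bas_comm_ab Bas_b). Qed.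

Lemma is_subgroup_gamma3 : is_subgroup gamma3.
Proof. exact: is_subgroup_ncl. Qed.

Lemma normal_gamma3 : normal_in Bas gamma3.
Proof. exact: (normal_ncl is_subgroup_Bas). Qed.

Lemma gamma3_Bas : gamma3 `<=` Bas.
Proof. exact: (ncl_sub is_subgroup_Bas Bas_comm_abb). Qed.

Lemma ncl_comm_ab_central f g : ncl Bas comm_ab f -> Bas g -> gamma3 [~ f, g].
Proof. exact: (ncl_central aut_aJb_comm comm_abJa). Qed.

Lemma noetherian_Bas : noetherian_over gamma3 Bas.
Proof. exact: (noetherian_third_term aut_aJb_comm comm_abJa). Qed.

Lemma ncl_deltas1_comm_ab : ncl Bas comm_ab (deltas [:: true] comm_ab).
Proof.
rewrite deltas1_comm_ab; have sC := is_subgroup_ncl Bas comm_ab.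
have Cc := ncl_mem is_subgroup_Bas comm_ab.
apply: (subgroupV sC); apply: (subgroupM sC) => //.
exact: (normal_ncl is_subgroup_Bas Cc Bas_b).
Qed.

Lemma ncl_deltas0_comm_ab : ncl Bas comm_ab (deltas [:: false] comm_ab).
Proof.
by rewrite deltas0_comm_ab;
  exact: (normal_ncl is_subgroup_Bas ncl_deltas1_comm_ab Bas_b).
Qed.

(** By [ncl_deltas] it is enough to place the generator [[a, b]] below a single letter. *)
Lemma ncl_comm_ab_deltas w g : ncl Bas comm_ab g ->
  ncl Bas comm_ab (deltas w g).
Proof.
elim: w => [|x w IHw] Cg; first by [].
rewrite -cat1s deltas_cat.
apply: (ncl_deltas (is_subgroup_ncl _ _) (normal_ncl is_subgroup_Bas
  (t:=comm_ab)) _ (IHw Cg)).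
by case: x; [exact: ncl_deltas1_comm_ab | exact: ncl_deltas0_comm_ab].
Qed.

(** A lift of [a^-1] undoes the conjugation by [a], and a lift of [b] carries the child 0 of [w] to
    the child 1. *)
Lemma deltas_child (K : set tree_aut) w : is_subgroup K -> normal_in Bas K ->
  K (deltas (rcons w false) (comm_abb ^ aut_a)) ->
  forall x g, gamma3 g -> K (deltas (rcons w x) g).
Proof.
move=> sK KJ Kd.
have K0 g : gamma3 g -> K (deltas (rcons w false) g).
  apply: (ncl_deltas sK KJ).
  have [k Bk ka] := Bas_sections (rcons w false) (subgroupV is_subgroup_Bas
    Bas_a).
  by rewrite -[comm_abb](conjgK aut_a) -(deltas_conj _ ka); exact: KJ.
case=> g Dg; last exact: K0.
have [k Bk kb] := Bas_sections w Bas_b.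
rewrite -cats1 deltas_cat -deltas0J -(deltas_conj _ kb) -deltas_cat cats1.
by apply: KJ => //; exact: K0.
Qed.

(** Below 0, [c = [a, b]] acts as [b ^ a], and [c] commutes with [a]: the section is [[c, b ^ a] =
    [c, b] ^ a]. *)
Lemma comm_deltas0_comm_ab :
  [~ deltas [:: false] comm_ab, comm_ab] = deltas [:: false] (comm_abb ^ aut_a).
Proof.
rewrite commgEl (deltas_conj _ acts_at_comm_ab) -deltasV -deltasM -commgEl.
by rewrite conjRg comm_abJa.
Qed.

(** The copy of [[a, b]] below 0 is central modulo [gamma3], so its commutator with [[a, b]] is the
    element required by [deltas_child]. *)
Lemma gamma3_deltas w g : gamma3 g -> gamma3 (deltas w g).
Proof.
elim: w => [|x w IHw] Dg; first by [].
rewrite -cat1s deltas_cat.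
apply: (@deltas_child _ [::] is_subgroup_gamma3 normal_gamma3 _ x _ (IHw Dg)).
rewrite /= -comm_deltas0_comm_ab.
exact: (ncl_comm_ab_central ncl_deltas0_comm_ab Bas_comm_ab).
Qed.

(** * Subgroups containing a copy of the third term *)

Lemma mkseq_add (x : nat -> bool) m n :
  mkseq x (m + n) = mkseq x m ++ mkseq (fun i => x (m + i)%N) n.
Proof. by rewrite /mkseq iotaD map_cat add0n -{2}[m]addn0 iotaDl -map_comp. Qed.

(** [[n, f] = (f^-1) ^ n * f], and the first factor lives below [n w], hence commutes with [g]. *)
Lemma comm_comm_rist w (n f g : tree_aut) : n w != w -> rist w f -> rist w g ->
  [~ [~ n, f], g] = [~ f, g].
Proof.
move=> nw fw gw.
have cg : f^-1 ^ n * g = g * f^-1 ^ n.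
  apply: (@rist_commute (n w) w) => //; first by rewrite size_tapp.
  by apply: ristJ; exact: (subgroupV (is_subgroup_rist w)).
rewrite [[~ n, f]]commgEr; move: (f^-1 ^ n) cg => u ug.
by rewrite !commgEl invgM conjMg [u ^ g]conjgE ug mulKg mulgA mulgVK.
Qed.

Lemma rist_acts_at1 u v f : size u = size v -> u != v -> rist u f ->
  acts_at v f 1.
Proof.
move=> suv uv fu z; rewrite fu //; apply/negP => uz; move/eqP: uv; apply.
exact: prefix_eq_size suv uz (prefix_prefix v z).
Qed.

Definition derived (K : set tree_aut) : set tree_aut :=
  gspan [set [~ f, g] | f in K & g in K].

Lemma derivedJ K g : (forall f, K f -> K (f ^ g)) ->
  forall f, derived K f -> derived K (f ^ g).
Proof.
move=> KJ; apply: gspan_min => [|_ [f Kf [h Kh <-]]].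
  apply: is_subgroup_preimage (is_subgroup_gspan _); first exact: conj1g.
  by move=> x y; rewrite conjMg conjVg.
rewrite /preimage /= conjRg; apply: sub_gspan.
by exists (f ^ g); [exact: KJ | exists (h ^ g); first exact: KJ].
Qed.

(** Some [[e, F]] in the derived subgroup moves a prefix [w] of the ray. By normality, double
    commutators with copies below [w] stay in that subgroup and yield the element required by
    [deltas_child]. *)
Lemma derived_gamma3_deltas (x : nat -> bool) :
  exists n, forall g, gamma3 g -> derived gamma3 (deltas (mkseq x n) g).
Proof.
have sD' : is_subgroup (derived gamma3) := is_subgroup_gspan _.
have D'J f g : derived gamma3 f -> Bas g -> derived gamma3 (f ^ g).
  by move=> + Bg; apply: derivedJ => h Dh; exact: normal_gamma3.
have [e De ew] := gamma3_moves (size_mkseq x 3).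
have [f Df fw] := gamma3_moves (size_mkseq (fun i => x (3 + i)%N) 3).
pose F := deltas (mkseq x 3) f; pose w := mkseq x (3 + 3).
have D'n : derived gamma3 [~ e, F].
  by apply: sub_gspan; exists e => //; exists F => //; exact: gamma3_deltas.
have nw : [~ e, F] w != w.
  (* [[e, F] = (F^-1) ^ e * F]; the first factor lives below another vertex of level 3. *)
  have ew1 : acts_at (mkseq x 3) (F^-1 ^ e) 1.
    apply: rist_acts_at1 ew _; first by rewrite size_tapp.
    by apply: ristJ; apply: (subgroupV (is_subgroup_rist _));
      exact: rist_deltas.
  rewrite commgEr tree_autME /w mkseq_add ew1 acts_at_deltas.
  by rewrite eqseq_cat // eqxx.
(* Three letters for [e], three for [f], and one for the child. *)
exists 7; rewrite [mkseq x 7](mkseq_add x 6 1) cats1 => g.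
apply: (deltas_child sD' D'J).
rewrite -cats1 deltas_cat -comm_deltas0_comm_ab deltasR.
rewrite -(comm_comm_rist nw (rist_deltas _ _) (rist_deltas _ _)).
have D'R k h : derived gamma3 k -> Bas h -> derived gamma3 [~ k, h].
  move=> D'k Bh; rewrite commgEl; apply: (subgroupM sD').
    exact: (subgroupV sD').
  exact: D'J.
have Bdeltas h : ncl Bas comm_ab h -> Bas (deltas w h).
  by move=> Ch; apply: (ncl_sub is_subgroup_Bas Bas_comm_ab);
    exact: ncl_comm_ab_deltas.
apply: (D'R); last by apply: Bdeltas; exact: (ncl_mem is_subgroup_Bas _).
by apply: (D'R) => //; apply: Bdeltas; exact: ncl_deltas0_comm_ab.
Qed.

Notation gamma3_at w := (deltas w @` gamma3).

Lemma is_subgroup_gamma3_at w : is_subgroup (gamma3_at w).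
Proof. by apply: is_subgroup_deltas; exact: is_subgroup_gamma3. Qed.

Lemma gamma3_at_cat u v : gamma3_at (u ++ v) `<=` gamma3_at u.
Proof.
move=> _ [g Dg <-]; exists (deltas v g); last by rewrite deltas_cat.
exact: gamma3_deltas.
Qed.

(** These commutators generate the copy of [derived gamma3] below [w]. *)
Lemma derived_deltas_at (K : set tree_aut) w (x : nat ->
  bool) : is_subgroup K ->
  (forall f g, gamma3 f -> gamma3 g -> K [~ deltas w f, deltas w g]) ->
  exists n, gamma3_at (w ++ mkseq x n) `<=` K.
Proof.
move=> sK KR; have [n nP] := derived_gamma3_deltas x; exists n => _ [g Dg <-].
rewrite deltas_cat; move: (deltas _ g) (nP g Dg).
apply: gspan_min; first exact: is_subgroup_preimage_deltas.
by move=> _ [f Df [h Dh <-]]; rewrite /preimage /= deltasR; exact: KR.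
Qed.

(** Among elements placed ever deeper along the ray, two agree modulo the normal core of [K]. Their
    quotient [n] moves a vertex [w], since the deeper one fixes [w]; double commutators with [n]
    finish. *)
Lemma finite_index_gamma3_at (K : set tree_aut) v (x : nat -> bool) :
  is_subgroup K -> finite_index (gamma3_at v) K ->
  exists n, gamma3_at (v ++ mkseq x n) `<=` K.
Proof.
move=> sK fiK; have sE := is_subgroup_gamma3_at v.
pose u i := v ++ mkseq x (3 * i).
have /choice[h hP] : forall i, exists h, gamma3 h /\
    h (mkseq (fun k => x (3 * i + k)%N) 3) != mkseq (fun k => x (3 * i + k)%N)
      3.
  by move=> i; have [h Dh hw] :=
    gamma3_moves (size_mkseq (fun k => x (3 * i + k)%N) 3); exists h.
pose f i := deltas (u i) (h i).
have Ef i : gamma3_at v (f i).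
  by apply: gamma3_at_cat; exists (h i) => //; exact: (hP i).1.
have [i [j [ij nP]]] :=
  finite_index_core sE sK fiK (fun i => subgroupV sE (Ef i)).
pose n := (f j)^-1^-1 * (f i)^-1;
  pose w := u i ++ mkseq (fun k => x (3 * i + k)%N) 3.
have wE : w = u i.+1 by rewrite /w /u mulnS addnC mkseq_add catA.
have fjw : f j w = w.
  have [t uj] : exists t, u j = w ++ t.
    rewrite wE /u -(subnKC ij) mulnDr mkseq_add catA; by eexists.
  apply: (@tapp_catl _ _ t _ _ erefl); rewrite -uj.
  exact: acts_at_fix (acts_at_deltas _ _).
have fiw : f i w != w.
  by rewrite acts_at_deltas eqseq_cat // eqxx; exact: (hP i).2.
have nw : n w != w.
  rewrite /n invgK tree_autME fjw; apply: contra fiw => /eqP fw.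
  by rewrite -{1}fw tappVK.
(* The normal core of [K] in [gamma3_at v]. *)
pose N : set tree_aut := gamma3_at v `&` [set m | forall y, gamma3_at v y ->
  K (m ^ y)].
have sN : is_subgroup N.
  apply: is_subgroupI => //; split=> [y _|m m' mK m'K y Ey].
    by rewrite conj1g; exact: sK.1.
  by rewrite conjMg conjVg; apply: sK.2; [exact: mK | exact: m'K].
have Nn : N n.
  split=> //; apply: (subgroupM sE); last exact: (subgroupV sE).
  by rewrite invgK.
have NR m y : N m -> gamma3_at v y -> N [~ m, y].
  move=> [Em mK] Ey; rewrite commgEl; apply: (subgroupM sN).
    by apply: (subgroupV sN); split.
  split=> [|z Ez]; first exact: (subgroupJ sE).
  by rewrite -conjgM; apply: mK; exact: (subgroupM sE).
have Ew g : gamma3 g -> gamma3_at v (deltas w g).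
  by move=> Dg; apply: (@gamma3_at_cat v (mkseq x (3 * i.+1)));
    rewrite -/(u i.+1) -wE; exists g.
have [||l lP] := @derived_deltas_at N w (fun k => x (3 * i.+1 + k)%N) => //.
  move=> f1 f2 D1 D2.
  rewrite -(comm_comm_rist nw (rist_deltas _ _) (rist_deltas _ _)).
  by apply: (NR _ _ (NR _ _ Nn (Ew _ D1)) (Ew _ D2)).
exists (3 * i.+1 + l)%N; rewrite mkseq_add catA -/(u _) -wE => m /lP[Em mK].
by rewrite -[m]conjg1; apply: mK; exact: sE.1.
Qed.

(** The finite index hypothesis, supplied by mass transport, is applied to [h] and then to an
    element [k] of [H] that acts below [v] as an element of [gamma3]. *)
Lemma gamma3_at_sub_nonfixed (H : set tree_aut) (x : nat -> bool) n h :
  is_subgroup H ->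
  (forall k w, H k -> finite_index (gamma3_at w)
    (gspan [set u | gamma3_at w u /\ H (k ^ u)])) ->
  H h -> h (mkseq x n) != mkseq x n ->
  exists m, gamma3_at (mkseq x m) `<=` H.
Proof.
move=> sH fiH Hh; set v := mkseq x n => hv.
have sD : is_subgroup gamma3 := is_subgroup_gamma3.
(* The elements of [H] inducing these sections may act arbitrarily outside the subtree at [v]. *)
pose Q : set tree_aut := gamma3 `&` [set g | exists2 k, H k & acts_at v k g].
have sQ : is_subgroup Q.
  apply: is_subgroupI => //; split; first by exists 1;
    [exact: sH.1 | exact: acts_at1].
  move=> f g [k Hk kf] [l Hl lg]; exists (k * l^-1); first exact: sH.2.
  exact: acts_atM kf (acts_atV lg).
have fiQ : finite_index (gamma3_at v) (deltas v @` Q).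
  apply: sub_finite_index (fiH h v Hh); apply: gspan_min => [|_ [[g Dg <-] Hg]].
    exact: is_subgroup_deltas.
  (* [[h, u] = (u^-1) ^ h * u], whose first factor lives below [h v], away from [v]. *)
  exists g => //; split=> //; exists [~ h, deltas v g].
    by rewrite commgEl; apply: (subgroupM sH) => //; exact: (subgroupV sH).
  rewrite commgEr -[g]mul1g; apply: acts_atM; last by rewrite mul1g;
    exact: acts_at_deltas.
  apply: rist_acts_at1 hv _; first by rewrite size_tapp.
  by apply: ristJ; rewrite -deltasV; exact: rist_deltas.
have [n1 n1P] := finite_index_gamma3_at (fun i => x (n + i)%N)
  (is_subgroup_deltas v sQ) fiQ.
set u1 := mkseq _ n1 in n1P.
have Q1 g : gamma3 g -> Q (deltas u1 g).
  move=> Dg; have /n1P[f Qf /esym] : gamma3_at (v ++ u1) (deltas (v ++ u1) g)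
    by exists g.
  rewrite deltas_cat => fE; suff -> : deltas u1 g = f by [].
  apply: (@acts_at_inj v (deltas v f)); last exact: acts_at_deltas.
  by rewrite -fE; exact: acts_at_deltas.
have vu1 : v ++ u1 = mkseq x (n + n1) by rewrite mkseq_add.
set w' := mkseq (fun i => x (n + n1 + i)%N) 3.
have [p Dp pw'] := gamma3_moves (size_mkseq (fun i => x (n + n1 + i)%N) 3).
have [_ [k Hk kp]] := Q1 p Dp.
pose w := v ++ u1 ++ w'.
have wE : w = mkseq x (n + n1 + 3) by rewrite /w catA vu1 (mkseq_add x (n +
  n1) 3).
have kw : k w != w.
  by rewrite kp eqseq_cat // eqxx acts_at_deltas eqseq_cat // eqxx.
(* conjugation by [gamma3_at w] agrees on [rist v] with conjugation by
   elements of [H] *)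
have HJ m u : H (deltas v m) -> gamma3_at w u -> H (deltas v m ^ u).
  move=> Hm [g Dg <-]; rewrite !deltas_cat -deltasJ.
  have [_ [l Hl lg]] := Q1 _ (gamma3_deltas w' Dg).
  by rewrite -(deltas_conj m lg); exact: (subgroupJ sH).
(* [k] fixes [v], so [[k, u]] is supported below [v], as [HJ] requires. *)
have kR u : gamma3_at w u -> exists m, [~ k, u] = deltas v m.
  move=> [g Dg <-]; rewrite deltas_cat commgEr -deltasV (deltas_conj _ kp).
  by rewrite -deltasM; eexists.
have sE := is_subgroup_gamma3_at w.
pose X : set tree_aut := gamma3_at w `&` [set u | H [~ k, u]].
have sX : is_subgroup X.
  split; first by split; [exact: sE.1 | rewrite /= commg1; exact: sH.1].
  move=> u u' [Eu Hu] [Eu' Hu']; split; rewrite /=; first exact: sE.2.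
  have -> : [~ k, u * u'^-1] = ([~ k, u']^-1 * [~ k, u]) ^ u'^-1.
    by rewrite /commg /conjg !gnorm.
  have [m mE] := kR u Eu; have [m' m'E] := kR u' Eu'.
  move: Hu Hu'; rewrite /= mE m'E -deltasV -deltasM => Hu Hu'.
  apply: HJ; last exact: (subgroupV sE).
  by rewrite deltasM deltasV; apply: (subgroupM sH) => //;
    exact: (subgroupV sH).
have fiX : finite_index (gamma3_at w) X.
  apply: sub_finite_index (fiH k w Hk); apply: gspan_min => // u [Eu Hu];
    split=> //=.
  by rewrite commgEl; apply: (subgroupM sH) => //; exact: (subgroupV sH).
have [n2 n2P] := finite_index_gamma3_at (fun i => x (n + n1 + 3 + i)%N) sX fiX.
set u2 := mkseq _ n2 in n2P.
have [||n3 n3P] := @derived_deltas_at H (w ++ u2)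
    (fun i => x (n + n1 + 3 + n2 + i)%N) => //.
  have kwu : k (w ++ u2) != w ++ u2.
    by apply: contra kw => /eqP/tapp_catl ->.
  move=> f g Df Dg; rewrite -(comm_comm_rist kwu (rist_deltas _ _)
    (rist_deltas _ _)).
  have [Ef Hf] : X (deltas (w ++ u2) f) by apply: n2P; exists f.
  have [Eg Hg] : X (deltas (w ++ u2) g) by apply: n2P; exists g.
  (* [[[k, f], g]] is [[k, f]^-1 * [k, f] ^ g], and [HJ] puts the second factor in [H]. *)
  rewrite [X in H X]commgEl; apply: (subgroupM sH); first exact: (subgroupV sH).
  have [m mE] := kR _ Ef; move: Hf; rewrite /= mE => Hf; exact: HJ.
exists (n + n1 + 3 + n2 + n3)%N; apply: subset_trans n3P.
by rewrite [mkseq x _]mkseq_add [mkseq x _]mkseq_add -wE.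
Qed.

(** * Mass transport for invariant random subgroups *)

Lemma mem_conj_subgroup (G : groupType) (g x : G) (H : subgroup G) :
  (x \in conj_subgroup g H) = (x ^ g^-1 \in H).
Proof. by []. Qed.

Lemma measurable_mem_subgroup (G : groupType) (g : G) :
  measurable [set H : borel_subgroup G | g \in H].
Proof.
apply: sub_sigma_algebra.
exists (@proj G (fun=> bool) g @^-1` [set b | b]); last by [].
apply: open_comp => [f _|]; first exact: (@proj_continuous G (fun=> bool)).
exact: discrete_open.
Qed.

Section FiniteIndex.
Variables (G : groupType) (R : realType).
Variable mu : probability (borel_subgroup G) R.
Hypothesis muIRS : is_IRS mu.
Variables (A : set G) (e : nat -> G) (h : G).
Hypothesis sA : is_subgroup A.
Hypothesis e_surj : forall g, exists n, e n = g.

Let first_at (x : G) (y : nat -> G) n : set (borel_subgroup G) :=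
  [set H | A (e n) /\ x \in H /\
    forall m, (m < n)%N -> A (e m) -> y m \notin H].

Let first_at_measurable x y n : measurable (first_at x y n).
Proof.
have [An|nAn] := pselect (A (e n)); last first.
  by rewrite (_ : first_at x y n = set0) // -subset0 => H [].
have -> : first_at x y n = [set H : borel_subgroup G | x \in H] `&`
    \bigcap_m (if `[< (m < n)%N /\ A (e m) >]
      then ~` [set H : borel_subgroup G | y m \in H] else setT).
  apply/seteqP; split=> H.
    move=> [_ [hH nH]]; split=> // m _; case: asboolP => // -[mn Am].
    exact/negP/nH.
  move=> [hH nH]; split=> //; split=> // m mn Am; apply/negP.
  by have := nH m I; rewrite asboolT.
apply: measurableI; first exact: measurable_mem_subgroup.
apply: bigcapT_measurable => m; case: ifP => // _.
exact: measurableC (measurable_mem_subgroup _).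
Qed.

(** The subgroups receiving mass through [e n]; their conjugates by [(e n)^-1], which form
    [shifted n], are the senders. *)
Let first n := first_at h (fun m => h ^ ((e m)^-1 * e n)) n.

Let shifted n : set (borel_subgroup G) := conj_subgroup (e n) @^-1` first n.

Let shiftedE n : shifted n =
  first_at (h ^ (e n)^-1) (fun m => h ^ (e m)^-1) n.
Proof.
apply/seteqP; split=> H [An [hH nH]]; split=> //; split=> // m mn Am.
  by have := nH m mn Am; rewrite mem_conj_subgroup -conjgM mulgK.
by rewrite mem_conj_subgroup -conjgM mulgK; exact: nH.
Qed.

Let shifted_triv :
  trivIset setT shifted.
Proof.
have aux m n H : (m < n)%N -> shifted m H ->
    shifted n H -> False.
  by rewrite !shiftedE => mn [Am [hm _]] [_ [_ nP]]; have := nP m mn Am;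
    rewrite hm.
move=> m n _ _ [H [Hm Hn]]; case: (ltngtP m n) => // mn.
  by case: (aux _ _ _ mn Hm Hn).
by case: (aux _ _ _ mn Hn Hm).
Qed.

(* Mass transport: a subgroup [K] sends mass one to [K ^ e n] for the least [n]
   with [h \in K ^ e n]; hence almost every [H] containing [h] is reached by
   finitely many of the [e n], although each coset of the span below has such
   an [e n]. *)
Lemma IRS_finite_index : {ae mu, forall H : borel_subgroup G, h \in H ->
  finite_index A (gspan [set u | A u /\ h ^ u \in H])}.
Proof.
exists (lim_sup_set first); split.
- apply: bigcapT_measurable => n; apply: bigcup_measurable => k _.
  exact: first_at_measurable.
(* Borel-Cantelli: by invariance [first n] has the mass of [shifted n], and the latter sets are
   disjoint. *)
- apply: lim_sup_set_cvg0 => [n|]; first exact: first_at_measurable.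
  rewrite (@eq_eseriesr _ _ (fun n => mu (shifted n)));
    last by move=> n _; rewrite /shifted muIRS //; exact: first_at_measurable.
  have mE n : measurable (shifted n).
    by rewrite shiftedE; exact: first_at_measurable.
  rewrite -measure_semi_bigcup //; last exact: bigcupT_measurable.
  by apply: Order.POrderTheory.le_lt_trans (probability_le1 _ _) (ltry _);
    exact: bigcupT_measurable.
- move=> H; apply: contra_notP => Hlim hH.
  have [n0 n0P] : exists n0, forall n, first n H -> (n < n0)%N.
    move/existsNP: Hlim => [n0 /not_implyP[_ nn0]]; exists n0 => n Hn.
    by rewrite ltnNge; apply/negP => n0n; apply: nn0; exists n.
  exists [seq e i | i <- iota 0 n0 & `[< A (e i) >]].
    by move=> _ /mapP[i + ->]; rewrite mem_filter => /andP[/asboolP].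
  move=> g Ag; set S := gspan _.
  have sS : is_subgroup S := is_subgroup_gspan _.
  have exP : exists n, `[< A (e n) /\ S ((e n)^-1 * g) >].
    have [n en] := e_surj g; exists n; apply/asboolP.
    by rewrite en mulVg; split=> //; exact: sS.1.
  (* The first [e n] in the coset of [g] puts [H] in [first n]: an earlier [m] with
     [h ^ ((e m)^-1 * e n)] in [H] would put [e m] in the same coset. *)
  case: (ex_minnP exP) => n /asboolP[An Sn] nmin; exists (e n) => //.
  apply/mapP; exists n => //; rewrite mem_filter mem_iota /= add0n.
  rewrite asboolT // n0P //; split=> //; split=> // m mn Am.
  apply/negP => hm; suff /nmin : `[< A (e m) /\ S ((e m)^-1 * g) >].
    by rewrite leqNgt mn.
  apply/asboolP; split=> //.
  have -> : (e m)^-1 * g = (e m)^-1 * e n * ((e n)^-1 * g).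
    by rewrite !mulgA mulgK.
  apply: (subgroupM sS) => //; apply: sub_gspan; split=> //.
  by apply: (subgroupM sA) => //; exact: (subgroupV sA).
Qed.

End FiniteIndex.

(** * Finite generation over the third term *)

(** Compactness of the boundary: otherwise the leftmost path through words with failures at every
    depth below them is a ray on which [P] never holds. *)
Lemma konig (P : seq bool -> Prop) : (forall w x, P w -> P (rcons w x)) ->
  (forall x : nat -> bool, exists n, P (mkseq x n)) ->
  exists m, forall w, size w = m -> P w.
Proof.
move=> Prcons Ppath; have Pcat w z : P w -> P (w ++ z).
  elim/last_ind: z => [|z x IHz] Pw; first by rewrite cats0.
  by rewrite -rcons_cat; apply: Prcons; exact: IHz.
pose bad w := forall m, exists2 z, size z = m & ~ P (w ++ z).
have bad_child w : bad w -> ~ bad (rcons w false) -> bad (rcons w true).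
  (* One letter selects the child; the other [m0 + m] can be cut to [m0] below the left child or to
     [m] below the right one. *)
  move=> bw /existsNP[m0 Pm0] m; have [z sz nPz] := bw (m0 + m).+1.
  have take_drop x z' : (m0 + m)%N = size z' ->
      ~ P (rcons w x ++ z') -> exists2 z, size z = m & ~ P (rcons w x ++ z).
    move=> sz' nP; exists (take m z');
      first by rewrite size_takel // -sz' leq_addl.
    by move=> PP; apply: nP; rewrite -[z'](cat_take_drop m) catA; exact: Pcat.
  case: z sz nPz => // -[] z [sz]; rewrite -cat_rcons => nPz.
    exact: take_drop nPz.
  exfalso; apply: Pm0; exists (take m0 z).
    by rewrite size_takel // sz leq_addr.
  by move=> PP; apply: nPz; rewrite -[z](cat_take_drop m0) catA; exact: Pcat.
apply: contrapT => /forallNP nex.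
have bad0 : bad [::].
  move=> m; have /existsNP[z /not_implyP[sz nPz]] := nex m; by exists z.
pose next w := if pselect (bad (rcons w false)) then false else true.
pose W n := iter n (fun w => rcons w (next w)) [::].
have badW n : bad (W n).
  elim: n => //= n IHn; rewrite /next; case: pselect => // nb.
  exact: bad_child.
have [n] := Ppath (fun n => next (W n)).
have -> : mkseq (fun n => next (W n)) n = W n.
  by elim: n => // n IHn; rewrite mkseqS IHn.
by have [z /size0nil -> ] := badW n 0%N; rewrite cats0.
Qed.

Lemma finite_representatives (T : eqType) (F : finType) (f : T ->
  F) (K : set T) :
  exists2 s : seq T, [set` s] `<=` K &
    forall g, K g -> exists2 r, r \in s & f r = f g.
Proof.
pose c y := if pselect (exists2 g, K g & f g = y) is left ex
  then Some (s2val (cid2 ex)) else None.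
have cP y g : c y = Some g -> K g /\ f g = y.
  by rewrite /c; case: pselect => // ex [<-]; split; case: cid2.
exists (pmap c (enum F)).
  move=> g; rewrite /= mem_pmap => /mapP[y _ /esym/cP[Kg _]]; exact: Kg.
move=> g Kg; case E : (c (f g)) => [r|]; last first.
  by move: E; rewrite /c; case: pselect => // -[]; exists g.
exists r; last exact: (cP _ _ E).2.
by rewrite mem_pmap -E map_f // mem_enum.
Qed.

Lemma gspan2_countable (G : groupType) (a b : G) :
  exists e : nat -> G, forall g, gspan [set a; b] g -> exists n, e n = g.
Proof.
pose gen (x : bool * bool) : G :=
  let y := if x.1 then a else b in if x.2 then y^-1 else y.
pose f s := foldl (fun g x => g * gen x) 1 s.
have fS s x : f (rcons s x) = f s * gen x by rewrite /f -cats1 foldl_cat.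
have genV x : (gen x)^-1 = gen (x.1, ~~ x.2).
  by case: x => [[] []]; rewrite /gen //= invgK.
exists (fun n => if unpickle n is Some s then f s else 1) => g.
suff: gspan [set a; b] `<=` [set g | exists s, f s = g].
  by move=> fP /fP[s <-]; exists (pickle s); rewrite pickleK.
apply: gspan_min => [|_ [->|->]].
- split; first by exists [::].
  move=> _ _ [s <-] [s' <-]; elim/last_ind: s' s => [|s' x IHs'] s.
    by exists s; rewrite divg1.
  have [t tE] := IHs' (rcons s (x.1, ~~ x.2)).
  by exists t; rewrite tE !fS invgM mulgA genV.
- by exists [:: (true, false)]; rewrite /f /= mul1g.
- by exists [:: (false, false)]; rewrite /f /= mul1g.
Qed.

Section LevelGenerators.
Variables (H : set tree_aut) (m : nat) (W : set (seq bool)).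
Hypothesis sH : is_subgroup H.
Hypothesis HB : H `<=` Bas.
Hypothesis HW : forall w, W w -> gamma3_at w `<=` H.
Hypothesis HnW : forall w, size w = m -> ~ W w -> forall h, H h ->
  acts_at w h 1.

Let N : set tree_aut := \bigcup_(w in W) gamma3_at w.

(** A filtration of the stabiliser of level [m]: trivial for empty [L], everything when [L] is the
    whole level. *)
Let stab (L : seq (seq bool)) : set tree_aut := [set g | [/\ H g,
  forall w, size w = m -> g w = w &
  forall w, size w = m -> w \notin L -> acts_at w g 1]].

Let is_subgroup_stab L : is_subgroup (stab L).
Proof.
split; first by split; [exact: sH.1 | | move=> w _ _; exact: acts_at1].
move=> g k [Hg gw gL] [Hk kw kL]; split; first exact: sH.2.
  by move=> w sw; rewrite tree_autME gw // -{1}(kw w sw) tappKV.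
move=> w sw wL; rewrite -[1](mulgV 1); apply: acts_atM; first exact: gL.
by apply: acts_atV; exact: kL.
Qed.

(** For [w] in [W], the sections at [w] form a group between [gamma3] and [Bas], so finitely many
    lifts, with [gamma3_at w], realise them all; dividing by such an element leads into [stab L]. *)
Let stab_cons w L : W w \/ ~ W w -> all (fun u => size u == m) (w :: L) ->
  (exists2 s : seq tree_aut, [set` s] `<=` stab L &
    stab L `<=` gspan (N `|` [set` s])) ->
  exists2 s : seq tree_aut, [set` s] `<=` stab (w :: L) &
    stab (w :: L) `<=` gspan (N `|` [set` s]).
Proof.
move=> WnW /andP[/eqP sw sL] [s sLs Ls].
have stabS g : stab (w :: L) g -> acts_at w g 1 -> stab L g.
  move=> [Hg gfix gL] gw; split=> // u su uL.
  have [->//|uw] := eqVneq u w; apply: gL => //.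
  by rewrite inE negb_or uw.
have stabS' g : stab L g -> stab (w :: L) g.
  move=> [Hg gfix gL]; split=> // u su; rewrite inE negb_or => /andP[_].
  exact: gL.
case: WnW => [Ww|nWw]; last first.
  exists s => g; first by move=> /sLs; exact: stabS'.
  by move=> Kg; apply: Ls; apply: stabS => //; apply: HnW => //; case: Kg.
have sK := is_subgroup_stab (w :: L).
pose sec (K : set tree_aut) : set tree_aut :=
  [set f | exists2 g, K g & acts_at w g f].
have sec_sub K : is_subgroup K -> is_subgroup (sec K).
  move=> sK'; split; first by exists 1; [exact: sK'.1 | exact: acts_at1].
  move=> f f' [g Kg gf] [g' Kg' gf']; exists (g * g'^-1); first exact: sK'.2.
  exact: acts_atM gf (acts_atV gf').
have Kdeltas f : gamma3 f -> stab (w :: L) (deltas w f).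
  move=> Df; split; first by apply: (HW Ww); exists f.
    move=> u su; have [->|uw] := eqVneq u w.
      exact: acts_at_fix (acts_at_deltas _ _).
    apply: rist_deltas; apply/negP => wu; move/eqP: uw; apply.
    by apply: (@prefix_eq_size _ _ u) => //; [rewrite sw | exact: prefix_refl].
  move=> u su; rewrite inE negb_or => /andP[uw _].
  by apply: rist_acts_at1 (rist_deltas _ _); rewrite ?sw // eq_sym.
have [f Df|f [g [Hg gfix _] gf]|t tK Kt] := noetherian_Bas (sec_sub _ sK).
- by exists (deltas w f); [exact: Kdeltas | exact: acts_at_deltas].
- have [f' Bf' gf'] := Bas_acts_at (HB Hg) (gfix w sw).
  by rewrite (acts_at_inj gf gf').
have /choice[l lP] : forall f, exists g, f \in t ->
    stab (w :: L) g /\ acts_at w g f.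
  move=> f; have [ft|_] := boolP (f \in t); last by exists 1.
  by have [g Kg gf] := tK f ft; exists g.
exists (map l t ++ s) => g.
  rewrite /= mem_cat => /orP[/mapP[f /lP[Kf _] -> //]|/sLs]; exact: stabS'.
set S := gspan _; have sS : is_subgroup S := is_subgroup_gspan _.
move=> Kg; have [Hg gfix _] := Kg.
have [f Bf gf] := Bas_acts_at (HB Hg) (gfix w sw).
have : gspan (gamma3 `|` [set` t]) `<=` sec (S `&` stab (w :: L)).
  apply: gspan_min; first by apply: sec_sub; exact: is_subgroupI.
  move=> f' [Df'|/= ft]; last first.
    have [Kl lf] := lP f' ft; exists (l f') => //; split=> //.
    by apply: sub_gspan; right; rewrite /= mem_cat map_f.
  exists (deltas w f'); last exact: acts_at_deltas.
  split; last exact: Kdeltas.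
  by apply: sub_gspan; left; exists w => //; exists f'.
have fK : sec (stab (w :: L)) f by exists g.
move=> /(_ _ (Kt _ fK))[g' [Sg' Kg'] g'f].
rewrite -[g](mulgVK g'); apply: (subgroupM sS) => //.
have : stab L (g * g'^-1).
  apply: stabS; first exact: sK.2.
  by rewrite -(mulgV f); apply: acts_atM gf (acts_atV g'f).
move=> /Ls; apply: gspan_mono => x [Nx|/= sx]; first by left.
by right; rewrite /= mem_cat sx orbT.
Qed.

Let stab_fg L : all (fun u => size u == m) L ->
  exists2 s : seq tree_aut, [set` s] `<=` stab L &
    stab L `<=` gspan (N `|` [set` s]).
Proof.
elim: L => [_|w L IHL sL]; last first.
  apply: stab_cons => //; first exact: EM.
  by apply: IHL; case/andP: sL.
exists [::] => // g [Hg gfix g1];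
  suff -> : g = 1 by exact: (is_subgroup_gspan _).1.
apply: tree_aut_inj => v.
have gw w z : size w = m -> g (w ++ z) = w ++ z.
  by move=> sw; rewrite (g1 w).
(* Shorter words are padded to level [m]; prefixes of fixed words are fixed. *)
have [vm|mv] := leqP (size v) m.
  apply: (@tapp_catl g v (nseq (m - size v) false)) => //.
  have := gfix (v ++ nseq (m - size v) false); apply.
  by rewrite size_cat size_nseq subnKC.
by rewrite -[v](cat_take_drop m) gw // size_takel // ltnW.
Qed.

(** Level [m] has finitely many permutations, so finitely many coset representatives complete the
    generators from [stab_fg]. *)
Lemma level_generators : exists s : seq tree_aut,
  [set` s] `<=` H /\ H = gspan (N `|` [set` s]).
Proof.
pose V := [seq val t | t <- enum {: m.-tuple bool}].
have memV w : (w \in V) = (size w == m).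
  apply/mapP/eqP => [[t _ ->]|sw]; first exact: size_tuple.
  by exists (Tuple (introT eqP sw)) => //; rewrite mem_enum.
have [s sV Vs] : exists2 s : seq tree_aut, [set` s] `<=` stab V &
    stab V `<=` gspan (N `|` [set` s]).
  by apply: stab_fg; apply/allP => w; rewrite memV.
have tsz (g : tree_aut) (t : m.-tuple bool) : size (g t) == m by rewrite
  size_tapp size_tuple.
pose f (g : tree_aut) := [ffun t : m.-tuple bool => Tuple (tsz g t)].
have [s' s'H Hs'] := finite_representatives f H.
exists (s' ++ s); split=> [g /=|].
  by rewrite mem_cat => /orP[/s'H//|/sV[]].
set S := gspan _; have sS : is_subgroup S := is_subgroup_gspan _.
apply/seteqP; split=> [g Hg|].
  have [r rs' fr] := Hs' g Hg.
  have Sr : S r by apply: sub_gspan; right; rewrite /= mem_cat rs'.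
  rewrite -[g](mulgVK r); apply: (subgroupM sS) => //.
  have : stab V (g * r^-1).
    split; first by apply: sH.2 => //; exact: s'H.
      move=> w sw; rewrite tree_autME.
      have := congr1 (fun k : {ffun _ -> _} =>
        val (k (Tuple (introT eqP sw)))) fr.
      by rewrite !ffunE /= => <-; rewrite tappK.
    by move=> w sw; rewrite memV sw eqxx.
  move=> /Vs; apply: gspan_mono => x [Nx|/= sx]; first by left.
  by right; rewrite /= mem_cat sx orbT.
apply: gspan_min => // g [[w Ww Dg]|/=]; first exact: HW Dg.
by rewrite mem_cat => /orP[/s'H//|/sV[]].
Qed.

End LevelGenerators.

(** * Fixed points on the boundary *)

Lemma open_cylinder (U : set cantor_space) x : open U -> U x ->
  exists n, forall y : cantor_space, (forall i, (i < n)%N -> y i = x i) -> U y.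
Proof.
(* The filter of cylinders around [x] converges coordinatewise, hence in the product topology. *)
move=> oU Ux; pose F : set_system cantor_space :=
  [set V | exists n, forall y : cantor_space, (forall i, (i < n)%N ->
    y i = x i) -> V y].
have FF : Filter F.
  split; first by exists 0%N.
    move=> V V' [n nV] [n' nV']; exists (maxn n n') => y yx.
    split; [apply: nV => i lt_in | apply: nV' => i lt_in]; apply: yx;
      by rewrite leq_max lt_in ?orbT.
  by move=> V V' VV' [n nV]; exists n => y /nV; exact: VV'.
suff Fx : F --> (x : prod_topology (fun _ : nat => bool)).
  by apply: Fx; exact: open_nbhs_nbhs.
apply/cvg_sup => i V; rewrite nbhsE => -[W [[C oC <-] Cx] WV].
exists i.+1 => y yx; apply: WV => /=.
by have -> : y i = x i by exact: yx.
Qed.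

Definition tree_image (H : subgroup basilica) : set tree_aut :=
  [set val h | h in [set h | h \in H]].

Lemma is_subgroup_tree_image H : is_subgroup (tree_image H).
Proof.
have [H1 HD] := subgroupP H.
split; first by exists 1; rewrite ?val1.
move=> _ _ [g Hg <-] [h Hh <-]; exists (g * h^-1); first exact: HD.
by rewrite valM gmulfV.
Qed.

Lemma tree_image_Bas H : tree_image H `<=` Bas.
Proof. by move=> _ [h _ <-]; exact: valP. Qed.

Lemma Fix_cylinder H (x : cantor_space) : open (Fix H) -> Fix H x ->
  exists n, forall h, tree_image H h -> acts_at (mkseq x n) h 1.
Proof.
move=> oF Fx; have [n nF] := open_cylinder oF Fx.
exists n => _ [h Hh <-] z.
(* The word, continued by zeros, is a point of the cylinder and therefore fixed. *)
pose y : cantor_space := nth false (mkseq x n ++ z).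
have yz : mkseq y (n + size z) = mkseq x n ++ z.
  by rewrite -{1}(size_mkseq x n) -size_cat mkseq_nth.
have Fy : Fix H y.
  by apply: nF => i lt_in; rewrite /y nth_cat size_mkseq lt_in nth_mkseq.
by rewrite -yz -mkseq_bact (Fy h Hh).
Qed.

Lemma notin_Fix H (x : cantor_space) : ~ Fix H x ->
  exists n h, tree_image H h /\ h (mkseq x n) != mkseq x n.
Proof.
move=> /existsNP[h /not_implyP[Hh hx]]; apply: contrapT => nex; apply: hx.
apply/funext => n; have hn : val h (mkseq x n.+1) = mkseq x n.+1.
  apply: contrapT => /eqP hn; apply: nex; exists n.+1, (val h); split=> //.
  by exists h.
by rewrite /bact hn mkseqS last_rcons.
Qed.

Lemma is_subgroup_preimage_val (K : set tree_aut) : is_subgroup K ->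
  is_subgroup ((val : basilica -> tree_aut) @^-1` K).
Proof.
apply: is_subgroup_preimage; first exact: val1.
by move=> x y; rewrite valM gmulfV.
Qed.

Lemma finite_index_tree_image (H : subgroup basilica) h w : h \in H ->
  finite_index [set g : basilica | gamma3_at w (val g)]
    (gspan [set u : basilica | gamma3_at w (val u) /\ h ^ u \in H]) ->
  finite_index (gamma3_at w)
    (gspan [set u | gamma3_at w u /\ tree_image H (val h ^ u)]).
Proof.
move=> Hh [s sA sP]; exists (map val s) => [_ /mapP[r rs ->]|g Dg];
  first exact: sA.
have Bg : Bas g.
  by case: Dg => f Df <-; apply: gamma3_Bas; exact: gamma3_deltas.
have [g' g'g] : exists g' : basilica, val g' = g by exists (Sub g Bg);
  exact: SubK.
have [|r rs rg] := sP g'; first by rewrite /= g'g.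
exists (val r); first exact: map_f.
have : (gspan [set u : basilica | gamma3_at w (val u) /\ h ^ u \in H]) `<=`
    (val : basilica -> tree_aut) @^-1`
    gspan [set u | gamma3_at w u /\ tree_image H (val h ^ u)].
  apply: gspan_min => [|u [Du Hu]].
    by apply: is_subgroup_preimage_val; exact: is_subgroup_gspan.
  rewrite /preimage /=; apply: (@sub_gspan tree_aut).
  by split=> //; exists (h ^ u) => //; rewrite gmulfJ.
by move=> /(_ _ rg); rewrite /preimage /mkset valM gmulfV g'g.
Qed.

(** * Countably many candidate subgroups *)

Lemma basilica_enumeration : exists e : nat ->
  basilica, forall g, exists n, e n = g.
Proof.
have [e eP] := gspan2_countable aut_a aut_b.
exists (fun n => insubd (1 : basilica) (e n)) => g.
by have [n en] := eP _ (valP g); exists n; rewrite en valKd.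
Qed.

(** The parameters are finite data over countable sets, which makes the family countable. *)
Definition level_subgroup (W : seq (seq bool)) (s : seq basilica) : subgroup
  basilica :=
  Subgroup (generated_group_closed
    [set g : basilica | (exists2 w, w \in W & gamma3_at w (val g)) \/ g \in s]).

Lemma clopen_Fix_level_subgroup (H : subgroup basilica) : clopen (Fix H) ->
  (forall h w, h \in H -> finite_index [set g : basilica | gamma3_at w (val g)]
    (gspan [set u : basilica | gamma3_at w (val u) /\ h ^ u \in H])) ->
  exists W s, H = level_subgroup W s.
Proof.
move=> [oF _] fiH; have sH := is_subgroup_tree_image H.
(* Both alternatives pass to children; rays in [Fix H] reach the first because [Fix H] is open,
   other rays the second. *)
pose P w := (forall h, tree_image H h -> acts_at w h 1) \/
  gamma3_at w `<=` tree_image H.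
have [m mP] : exists m, forall w, size w = m -> P w.
  apply: konig => [w x [Pw|Pw]|x]; rewrite /P.
  - left=> h /Pw hw; rewrite -cats1; exact: acts_at_cat hw (acts_at1 _).
  - by right; apply: subset_trans Pw; rewrite -cats1; exact: gamma3_at_cat.
  have [Fx|/notin_Fix[n [h [Hh hn]]]] := pselect (Fix H x).
    by have [n nP] := Fix_cylinder oF Fx; exists n; left.
  have [|k kP] := gamma3_at_sub_nonfixed sH _ Hh hn; last by exists k; right.
  by move=> _ w [k Hk <-]; apply: finite_index_tree_image => //; exact: fiH.
pose V := [seq val t | t <- enum {: m.-tuple bool}].
pose W := [seq w <- V | `[< gamma3_at w `<=` tree_image H >]].
have [|||s [sH' HE]] := @level_generators (tree_image H) m [set` W] sH.
- exact: tree_image_Bas.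
- by move=> w; rewrite /= mem_filter => /andP[/asboolP].
- move=> w sw wW; have [//|Dw] := mP w sw; exfalso; apply: wW.
  rewrite /= mem_filter asboolT //=; apply/mapP.
  by exists (Tuple (introT eqP sw)) => //; rewrite mem_enum.
(* The default 1 never occurs, since [s] lies in [Bas]. *)
pose s' := [seq insubd (1 : basilica) g | g <- s].
exists W, s'; apply: subgroup_inj; apply/funext => g; apply/idP/idP => [Hg|].
  have : gspan (\bigcup_(w in [set` W]) gamma3_at w `|` [set` s]) `<=`
      [set val h | h in gspan [set g : basilica |
        (exists2 w, w \in W & gamma3_at w (val g)) \/ g \in s']].
    apply: gspan_min.
      split; first by exists 1; [exact: (is_subgroup_gspan _).1 | rewrite val1].
      move=> _ _ [x Sx <-] [y Sy <-]; exists (x * y^-1).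
        exact: (is_subgroup_gspan _).2.
      by rewrite valM gmulfV.
    move=> x Nx; have Bx : Bas x.
      case: Nx => [[w _ [f Df <-]]|/sH'/tree_image_Bas //].
      by apply: gamma3_Bas; exact: gamma3_deltas.
    exists (insubd (1 : basilica) x); last by rewrite val_insubd Bx.
    apply: sub_gspan; case: Nx => [[w Ww Dx]|sx].
      by left; exists w => //; rewrite val_insubd Bx.
    by right; exact: map_f.
  rewrite -HE => /(_ (val g)) [|h Sh /val_inj <- //]; by exists g.
move/asboolP; apply=> x [[w]|/mapP[y ys ->]].
  by rewrite mem_filter => /andP[/asboolP WH _] /WH[h Hh /val_inj <-].
have [h Hh <-] := sH' y ys; by rewrite valKd.
Qed.

Theorem corollary6p4 (R : realType)
  (mu : probability (borel_subgroup basilica) R)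
  (mu_ergodic : ergodic_IRS mu)
  (mu_clopen : {ae mu, forall H, clopen (Fix H)}) :
  atomic mu.
Proof.
have [e e_surj] := basilica_enumeration.
have fi n w : {ae mu, forall H : borel_subgroup basilica, e n \in H ->
    finite_index [set g : basilica | gamma3_at w (val g)]
      (gspan [set u : basilica | gamma3_at w (val u) /\ e n ^ u \in H])}.
  apply: (@IRS_finite_index basilica R mu mu_ergodic.1 _ e) => //.
  by apply: is_subgroup_preimage_val; exact: is_subgroup_gamma3_at.
pose dec n : seq (seq bool) * seq nat :=
  if unpickle n is Some p then p else ([::], [::]).
pose S n : borel_subgroup basilica :=
  level_subgroup (dec n).1 (map e (dec n).2).
have range_S : {ae mu, forall H, exists n, H = S n}.
  (* Group elements and vertices are indexed by naturals so that one null set serves them all. *)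
  have fi' : {ae mu, forall H : borel_subgroup basilica,
      forall n k, e n \in H ->
      finite_index [set g : basilica | gamma3_at (odflt [::] (unpickle k))
        (val g)]
      (gspan [set u : basilica | gamma3_at (odflt [::] (unpickle k)) (val u)
        /\ e n ^ u \in H])}.
    apply: ae_foralln => n; apply: ae_foralln => k; exact: fi.
  near=> H; have [||W [s HE]] := @clopen_Fix_level_subgroup H.
  - by near: H.
  - move=> h w; have [n <-] := e_surj h.
    have : forall n k, e n \in H ->
      finite_index [set g : basilica | gamma3_at (odflt [::] (unpickle k))
        (val g)]
      (gspan [set u : basilica | gamma3_at (odflt [::] (unpickle k)) (val u)
        /\ e n ^ u \in H]).
      by near: H.
    by move=> /(_ n (pickle w)); rewrite pickleK.
  have [t ts] : exists t, s = map e t.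
    elim: s {HE} => [|g s [t ->]]; first by exists [::].
    by have [n <-] := e_surj g; exists (n :: t).
  by exists (pickle (W, t)); rewrite /S /dec pickleK /= -ts.
(* Without atoms, [A] is covered by the null complement of the range of [S] and countably many null
   sets. *)
move=> A mA; apply: contraPP => nex; apply/negP;
  rewrite -Order.TotalTheory.leNgt.
suff : mu.-negligible A by move=> /measure_negligible -> //.
have AS : A `<=` ~` [set H | exists n, H = S n] `|` \bigcup_n (A `&` [set S n]).
  move=> H AH; have [[n HS]|nS] := pselect (exists n, H = S n); last by left.
  by right; exists n => //; split.
apply: (negligibleS AS); apply: negligibleU => //;
  apply: negligible_bigcup => n.
have [ASn|nAS] := pselect (A (S n)); last first.
  suff -> : A `&` [set S n] = set0 by exact: negligible_set0.
  by rewrite -subset0 => H [AH HS]; apply: nAS; rewrite -HS.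
apply: negligibleS (@subIsetr _ A [set S n]) _.
exists [set S n]; split=> //; first exact: measurable_set1_subgroup.
apply/eqP; rewrite -measure_le0 Order.TotalTheory.leNgt; apply/negP => pos.
by apply: nex; exists (S n).
Unshelve. all: by end_near.
Qed.
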